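(* Let $\Omega$ be a simply connected, proper subdomain of $\mathbb{C}$ containing $0$. Let $f$ be the unique conformal mapping of $\mathbb{D}$ onto $\Omega$ such that $f(0)=0$ and $f'(0)>0$. Then the following statements are equivalent: (i) $\Omega$ is circularly symmetric; (ii) $f(\overline{z})=\overline{f(z)}$ for all $z\in\mathbb{D}$ and, for each $r\in(0,1)$, the map $\theta\mapsto|f(re^{i\theta})|$ is decreasing on $[0,\pi]$.
   Context: $\mathbb{D}=\{z\in\mathbb{C}:|z|<1\}$. A domain is a nonempty connected open subset of $\mathbb{C}$; a conformal mapping of $\mathbb{D}$ onto $\Omega$ is a holomorphic bijection $\mathbb{D}\to\Omega$. A plane domain $\Omega$ is called circularly symmetric (about $0$) if its intersection with each circle centred at the origin is either empty, or the whole circle, or consists of a subarc of the circle centred on the positive $x$-axis (i.e. a subarc whose midpoint lies on the positive real axis). ''Decreasing'' is meant in the weak sense (non-increasing). *)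

(* Defs.v *)
From Stdlib Require Import Reals.
From Coquelicot Require Import Coquelicot.
Open Scope R_scope.

Definition unit_disc (z : C) : Prop := Cmod z < 1.

Definition connected (A : C -> Prop) : Prop :=
  forall U V : C -> Prop,
    open U -> open V ->
    (forall z, A z -> U z \/ V z) ->
    (exists z, A z /\ U z) ->
    (exists z, A z /\ V z) ->
    exists z, A z /\ U z /\ V z.

Definition plane_domain (A : C -> Prop) : Prop :=
  (exists z, A z) /\ open A /\ connected A.

Definition unit_interval (t : R) : Prop := 0 <= t <= 1.

Definition unit_square (p : R * R) : Prop :=
  unit_interval (fst p) /\ unit_interval (snd p).

Definition path_in (A : C -> Prop) (g : R -> C) : Prop :=
  continuous_on unit_interval g /\ (forall t, unit_interval t -> A (g t)).

Definition path_connected (A : C -> Prop) : Prop :=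
  forall z w, A z -> A w -> exists g, path_in A g /\ g 0 = z /\ g 1 = w.

(* Homotopies [H (s, t)] have deformation parameter [s] and keep the base
   point of the loop fixed. *)
Definition null_homotopic (A : C -> Prop) (g : R -> C) : Prop :=
  exists H : R * R -> C,
    continuous_on unit_square H /\
    (forall p, unit_square p -> A (H p)) /\
    (forall t, unit_interval t -> H (0, t) = g t) /\
    (forall t, unit_interval t -> H (1, t) = g 0) /\
    (forall s, unit_interval s -> H (s, 0) = g 0 /\ H (s, 1) = g 0).

Definition simply_connected (A : C -> Prop) : Prop :=
  path_connected A /\
  (forall g, path_in A g -> g 0 = g 1 -> null_homotopic A g).

(* Maps on a subset of the plane are total functions [C -> C] of which only
   the values on that subset matter.  [ex_derive] is complex differentiability:
   the scalar field is [C_AbsRing]. *)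
Definition holomorphic_on (A : C -> Prop) (f : C -> C) : Prop :=
  forall z : C, A z -> @ex_derive C_AbsRing C_NormedModule f z.

Definition bijection_onto (A B : C -> Prop) (f : C -> C) : Prop :=
  (forall z, A z -> B (f z)) /\
  (forall z w, A z -> A w -> f z = f w -> z = w) /\
  (forall w, B w -> exists z, A z /\ f z = w).

Definition conformal_onto (A B : C -> Prop) (f : C -> C) : Prop :=
  holomorphic_on A f /\ bijection_onto A B f.

(* In particular the derivative exists and is a real number. *)
Definition positive_derivative_at (f : C -> C) (z : C) : Prop :=
  exists c : R, 0 < c /\ @is_derive C_AbsRing C_NormedModule f z (RtoC c).

(* r e^{it} *)
Definition polar (r t : R) : C := (r * cos t, r * sin t).

(* [A] is a nondegenerate subarc of the circle of radius [r] whose midpoint is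
   [r]; each endpoint [polar r (- a)], [polar r a] may or may not belong
   to [A]. *)
Definition centred_subarc (r : R) (A : C -> Prop) : Prop :=
  exists (a : R) (I : R -> Prop),
    0 < a <= PI /\
    (forall t, - a < t < a -> I t) /\
    (forall t, I t -> - a <= t <= a) /\
    (forall z, A z <-> exists t, I t /\ z = polar r t).

Definition circularly_symmetric (A : C -> Prop) : Prop :=
  forall r : R, 0 < r ->
    (forall z, Cmod z = r -> ~ A z) \/
    (forall z, Cmod z = r -> A z) \/
    centred_subarc r (fun z => Cmod z = r /\ A z).

Definition decreasing_on (a b : R) (g : R -> R) : Prop :=
  forall s t, a <= s -> s <= t -> t <= b -> g t <= g s.

(* Main.v *)
Require Import Defs.
From Stdlib Require Import Reals Lra Psatz ClassicalEpsilon.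
From Coquelicot Require Import Coquelicot.
Open Scope R_scope.

(* Let F be the inverse of f.  Circular symmetry of an open set says that
   moving a point to the right on its circle about 0 does not leave the set.
   For |c| = 1, the maximum principle for F(c f(z)) / z on the closed set where
   Re f(z) <= Re (c f(z)) then shows |F(c f(z))| <= |z| there: thus |F|
   increases along the arcs of the upper half plane leading away from the
   positive axis.  Differentiating, this is equivalent to
   Im (z f'(z) / f(z)) >= 0 on the upper half disc, that is, to the monotonicity
   of |f| on the upper half circles.  Conversely, if |F| increases along these
   arcs, then going from a point of Omega towards the positive axis one stays
   in the compact set f({|z| <= r}), hence in Omega.

   The complex analysis that is needed (openness of f, f' <> 0, Schwarz lemma)
   is all deduced from the maximum principle, itself a consequence of Goursat's
   argument in logarithmic polar coordinates. *)

(** * Goursat's theorem for real differential forms *)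

(** The obstacle is how little regularity is at hand. Pointwise complex differentiability says
    nothing yet about [f'], neither continuity nor differentiability, so a difference quotient is
    known to be continuous at its base point but not differentiable there. Hence the maximum
    principle with an exceptional point, and an argument for [f' <> 0] that avoids power series. In
    the main estimate the origin causes no trouble for another reason: it lies on [Re f = Re (c f)]
    and the quotient has there the value [c], of modulus 1, so it counts as a boundary point.

    The maximum principles speak of no boundary: each point of the closed set either satisfies the
    bound or has a neighbourhood in the set. The region cut out by [Re f <= Re (c f)] can then be
    used without describing its shape.

    One sign condition serves both monotonicities because [F' = 1 / f'] at [w = f z]:
    counterclockwise, [|f|^2] has derivative [-2 Im (z f' conj w)] at [z], while that of [|F|^2] at
    [w] is [2 Im (z f' conj w) / |f'|^2]. *)

Lemma nested_segments (a b : nat -> R) :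
  (forall n, a n <= b n) -> (forall n, a n <= a (S n)) ->
  (forall n, b (S n) <= b n) -> exists x, forall n, a n <= x <= b n.
Proof.
  intros Hab Ha Hb.
  assert (Ha' : forall n m, a n <= a (n + m)%nat).
  { intros n m; induction m as [|m IH].
    - rewrite Nat.add_0_r; lra.
    - rewrite Nat.add_succ_r; specialize (Ha (n + m)%nat); lra. }
  assert (Hb' : forall n m, b (n + m)%nat <= b n).
  { intros n m; induction m as [|m IH].
    - rewrite Nat.add_0_r; lra.
    - rewrite Nat.add_succ_r; specialize (Hb (n + m)%nat); lra. }
  assert (H : forall n m, a n <= b m).
  { intros n m; specialize (Ha' n m); specialize (Hb' m n);
    specialize (Hab (n + m)%nat); rewrite (Nat.add_comm m n) in Hb'; lra. }
  destruct (completeness (fun x => exists n, x = a n)) as [x [Hx1 Hx2]].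
  - exists (b 0%nat); intros x [n ->]; apply H.
  - exists (a 0%nat); exists 0%nat; reflexivity.
  - exists x; intros n; split.
    + apply Hx1; exists n; reflexivity.
    + apply Hx2; intros y [m ->]; apply H.
Qed.

Lemma half_pow_small (L e : R) : 0 < e -> exists n, L * (/ 2) ^ n < e.
Proof.
  intros He.
  destruct (pow_lt_1_zero (/ 2)) with (y := e / (1 + Rabs L)) as [N HN].
  - rewrite Rabs_pos_eq; lra.
  - apply Rdiv_lt_0_compat; [lra | pose proof (Rabs_pos L); lra].
  - exists N; specialize (HN N (Nat.le_refl N)).
    assert (0 < (/ 2) ^ N) by (apply pow_lt; lra).
    rewrite Rabs_pos_eq in HN by lra.
    pose proof (Rabs_pos L); pose proof (Rle_abs L).
    apply Rmult_lt_compat_r with (r := 1 + Rabs L) in HN; [|lra].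
    unfold Rdiv in HN; rewrite Rmult_assoc, Rinv_l in HN by lra.
    nra.
Qed.

(** Stands in for compactness, both in Goursat's argument and for the existence of maxima: the
    nested quarters that keep [P] shrink to a point. *)
Lemma rectangle_bisection (P : R -> R -> R -> R -> Prop) :
  (forall a b c d, a <= b -> c <= d -> P a b c d ->
     P a ((a + b) / 2) c ((c + d) / 2) \/ P ((a + b) / 2) b c ((c + d) / 2) \/
     P a ((a + b) / 2) ((c + d) / 2) d \/ P ((a + b) / 2) b ((c + d) / 2) d) ->
  forall a b c d, a <= b -> c <= d -> P a b c d ->
  exists x y, (a <= x <= b) /\ (c <= y <= d) /\
    forall e, 0 < e -> exists a' b' c' d',
      (a <= a' <= x) /\ (x <= b' <= b) /\ (c <= c' <= y) /\ (y <= d' <= d) /\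
      b' - a' < e /\ d' - c' < e /\ P a' b' c' d'.
Proof.
  intros HP a b c d Hab Hcd H0.
  set (good := fun q : R * R * (R * R) =>
    let '((a, b), (c, d)) := q in a <= b /\ c <= d /\ P a b c d).
  set (next := fun q q' : R * R * (R * R) =>
    let '((a, b), (c, d)) := q in let '((a', b'), (c', d')) := q' in
    (a <= a') /\ (b' <= b) /\ (c <= c') /\ (d' <= d) /\
    b' - a' = (b - a) * / 2 /\ d' - c' = (d - c) * / 2).
  (* The hypothesis [good q] sits under the existential so that choice yields a total function
     [step], which can be iterated without carrying proofs. *)
  assert (Hs : forall q, exists q', good q -> good q' /\ next q q').
  { intros [[p q] [r s]].
    destruct (classic (good ((p, q), (r, s)))) as [[G1 [G2 G3]] | G].
    - destruct (HP _ _ _ _ G1 G2 G3) as [G | [G | [G | G]]].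
      + exists ((p, (p + q) / 2), (r, (r + s) / 2)); simpl; intros _.
        repeat split; try lra; exact G.
      + exists (((p + q) / 2, q), (r, (r + s) / 2)); simpl; intros _.
        repeat split; try lra; exact G.
      + exists ((p, (p + q) / 2), ((r + s) / 2, s)); simpl; intros _.
        repeat split; try lra; exact G.
      + exists (((p + q) / 2, q), ((r + s) / 2, s)); simpl; intros _.
        repeat split; try lra; exact G.
    - exists ((p, q), (r, s)); intros G'; contradiction. }
  set (step := fun q => proj1_sig (constructive_indefinite_description _ (Hs q))).
  assert (Hstep : forall q, good q -> good (step q) /\ next q (step q)).
  { intros q; unfold step.
    destruct (constructive_indefinite_description _ (Hs q)) as [q' Hq']; exact Hq'. }
  clearbody step.
  set (u := fix u n := match n with O => ((a, b), (c, d)) | S n => step (u n) end).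
  assert (Hu : forall n, good (u n)).
  { induction n as [|n IH]; [simpl; tauto | apply (Hstep _ IH)]. }
  assert (Hn : forall n, next (u n) (u (S n))) by (intros n; apply (Hstep _ (Hu n))).
  assert (Hw : forall n, snd (fst (u n)) - fst (fst (u n)) = (b - a) * (/ 2) ^ n /\
                         snd (snd (u n)) - fst (snd (u n)) = (d - c) * (/ 2) ^ n /\
                         a <= fst (fst (u n)) /\ snd (fst (u n)) <= b /\
                         c <= fst (snd (u n)) /\ snd (snd (u n)) <= d).
  { induction n as [|n IH]; [simpl; repeat split; lra|].
    specialize (Hn n); revert IH Hn; simpl (_ ^ S n).
    destruct (u n) as [[p q] [r s]], (u (S n)) as [[p' q'] [r' s']]; simpl.
    intros (I1 & I2 & I3 & I4 & I5 & I6) (J1 & J2 & J3 & J4 & J5 & J6).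
    rewrite J5, J6, I1, I2; repeat split; lra. }
  destruct (nested_segments (fun n => fst (fst (u n))) (fun n => snd (fst (u n)))) as [x Hx].
  1-3: intros n; specialize (Hu n); specialize (Hn n); revert Hu Hn;
    destruct (u n) as [[p q] [r s]], (u (S n)) as [[p' q'] [r' s']]; simpl; tauto.
  destruct (nested_segments (fun n => fst (snd (u n))) (fun n => snd (snd (u n)))) as [y Hy].
  1-3: intros n; specialize (Hu n); specialize (Hn n); revert Hu Hn;
    destruct (u n) as [[p q] [r s]], (u (S n)) as [[p' q'] [r' s']]; simpl; tauto.
  exists x, y; split; [exact (Hx 0%nat) | split; [exact (Hy 0%nat)|]].
  intros e He.
  destruct (half_pow_small ((b - a) + (d - c)) e He) as [n Hsm].
  assert (0 < (/ 2) ^ n) by (apply pow_lt; lra).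
  specialize (Hx n); specialize (Hy n); specialize (Hw n); specialize (Hu n).
  revert Hx Hy Hw Hu; destruct (u n) as [[p q] [r s]]; simpl.
  intros Hx Hy (I1 & I2 & I3 & I4 & I5 & I6) (G1 & G2 & G3).
  exists p, q, r, s; rewrite I1, I2.
  repeat split; try lra; try exact G3; nra.
Qed.

Lemma continuous_R_ball (f : R -> R) (x : R) :
  continuous f x <->
  forall e, 0 < e -> exists d, 0 < d /\ forall y, Rabs (y - x) < d -> Rabs (f y - f x) < e.
Proof.
  split.
  - intros H e He.
    destruct (proj1 (filterlim_locally f (f x)) H (mkposreal e He)) as [d Hd].
    exists d; split; [apply cond_pos | intros y Hy; exact (Hd y Hy)].
  - intros H; apply filterlim_locally; intros e.
    destruct (H e (cond_pos e)) as [d [Hd0 Hd]].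
    exists (mkposreal d Hd0); intros y Hy; exact (Hd y Hy).
Qed.

Lemma differentiable_pt_lim_continuous (f : R -> R -> R) (x y lx ly : R) :
  differentiable_pt_lim f x y lx ly ->
  continuous (fun u => f u y) x /\ continuous (fun v => f x v) y.
Proof.
  intros H.
  assert (H' : continuity_2d_pt f x y).
  { apply differentiable_continuity_pt; exists lx, ly; exact H. }
  split; apply continuous_R_ball; intros e He;
    destruct (H' (mkposreal e He)) as [d Hd]; exists d; (split; [apply cond_pos|]);
    intros z Hz; apply Hd; try exact Hz; rewrite Rminus_diag, Rabs_R0; apply cond_pos.
Qed.

Lemma RInt_near_const (f : R -> R) (a b l e : R) :
  a <= b -> ex_RInt f a b -> (forall x, a <= x <= b -> Rabs (f x - l) <= e) ->
  Rabs (RInt f a b - l * (b - a)) <= e * (b - a).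
Proof.
  intros Hab Hf H.
  assert (H1 : RInt (fun _ => l - e) a b <= RInt f a b).
  { apply RInt_le; [exact Hab | apply ex_RInt_const | exact Hf |].
    intros x Hx; specialize (H x ltac:(lra)); apply Rabs_le_between in H; lra. }
  assert (H2 : RInt f a b <= RInt (fun _ => l + e) a b).
  { apply RInt_le; [exact Hab | exact Hf | apply ex_RInt_const |].
    intros x Hx; specialize (H x ltac:(lra)); apply Rabs_le_between in H; lra. }
  rewrite RInt_const in H1, H2; unfold scal in H1, H2; simpl in H1, H2;
  unfold mult in H1, H2; simpl in H1, H2.
  apply Rabs_le; lra.
Qed.

(** The counterclockwise integral of the form [A dx + B dy] around the rectangle: bottom and top
    sides in the first term, right and left sides in the second. *)
Definition boundary_integral (A B : R -> R -> R) (a b c d : R) : R :=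
  RInt (fun x => A x c - A x d) a b + RInt (fun y => B b y - B a y) c d.

Lemma boundary_integral_split (A B : R -> R -> R) (a b c d m n : R) :
  a <= m <= b -> c <= n <= d ->
  (forall x y, a <= x <= b -> c <= y <= d ->
     continuous (fun u => A u y) x /\ continuous (fun v => B x v) y) ->
  boundary_integral A B a b c d =
    boundary_integral A B a m c n + boundary_integral A B m b c n +
    (boundary_integral A B a m n d + boundary_integral A B m b n d).
Proof.
  intros Hm Hn H; unfold boundary_integral.
  assert (HA : forall p q y y', a <= p -> p <= q -> q <= b -> c <= y <= d -> c <= y' <= d ->
             ex_RInt (fun x => A x y - A x y') p q).
  { intros p q y y' H1 H2 H3 H4 H5; apply (ex_RInt_minus (V := R_NormedModule));
      apply (ex_RInt_continuous (V := R_CompleteNormedModule)); intros z Hz;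
      rewrite Rmin_left, Rmax_right in Hz by lra; apply H; lra. }
  assert (HB : forall p q x x', c <= p -> p <= q -> q <= d -> a <= x <= b -> a <= x' <= b ->
             ex_RInt (fun y => B x y - B x' y) p q).
  { intros p q y y' H1 H2 H3 H4 H5; apply (ex_RInt_minus (V := R_NormedModule));
      apply (ex_RInt_continuous (V := R_CompleteNormedModule)); intros z Hz;
      rewrite Rmin_left, Rmax_right in Hz by lra; apply H; lra. }
  assert (EA : RInt (fun x => A x c - A x d) a b =
     RInt (fun x => A x c - A x n) a m + RInt (fun x => A x c - A x n) m b +
     (RInt (fun x => A x n - A x d) a m + RInt (fun x => A x n - A x d) m b)).
  { transitivity (RInt (fun x => A x c - A x n) a b + RInt (fun x => A x n - A x d) a b).
    - rewrite <- (RInt_plus (V := R_CompleteNormedModule)) by (apply HA; lra).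
      apply RInt_ext; intros x _; unfold plus; simpl; ring.
    - rewrite <- (RInt_Chasles (fun x => A x c - A x n) a m b) by (apply HA; lra).
      rewrite <- (RInt_Chasles (fun x => A x n - A x d) a m b) by (apply HA; lra).
      reflexivity. }
  assert (EB : RInt (fun y => B b y - B a y) c d =
     RInt (fun y => B m y - B a y) c n + RInt (fun y => B b y - B m y) c n +
     (RInt (fun y => B m y - B a y) n d + RInt (fun y => B b y - B m y) n d)).
  { transitivity (RInt (fun y => B m y - B a y) c d + RInt (fun y => B b y - B m y) c d).
    - rewrite <- (RInt_plus (V := R_CompleteNormedModule)) by (apply HB; lra).
      apply RInt_ext; intros x _; unfold plus; simpl; ring.
    - rewrite <- (RInt_Chasles (fun y => B m y - B a y) c n d) by (apply HB; lra).
      rewrite <- (RInt_Chasles (fun y => B b y - B m y) c n d) by (apply HB; lra).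
      unfold plus; simpl; ring. }
  rewrite EA, EB; ring.
Qed.

(** The shared number [ay] says that [A dx + B dy] is closed at the point. The linear parts of [A]
    and [B] therefore contribute opposite amounts, and only the remainders, at most [eta / 4 * M] on
    each side, are left. *)
Lemma boundary_integral_small (A B : R -> R -> R) (x y ax ay bx : R) (eta : R) :
  0 < eta ->
  differentiable_pt_lim A x y ax ay -> differentiable_pt_lim B x y ay bx ->
  exists e, 0 < e /\ forall a b c d,
    a <= x <= b -> c <= y <= d -> b - a < e -> d - c < e ->
    (forall u v, a <= u <= b -> c <= v <= d ->
       continuous (fun u => A u v) u /\ continuous (fun v => B u v) v) ->
    Rabs (boundary_integral A B a b c d) <= eta * ((b - a) ^ 2 + (d - c) ^ 2).
Proof.
  intros Heta HA HB.
  assert (He4 : 0 < eta / 4) by lra.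
  destruct (HA (mkposreal _ He4)) as [dA HdA].
  destruct (HB (mkposreal _ He4)) as [dB HdB].
  simpl in HdA, HdB.
  exists (Rmin dA dB); split; [apply Rmin_pos; apply cond_pos|].
  intros a b c d Hx Hy Hab Hcd Hc.
  pose proof (Rmin_l dA dB); pose proof (Rmin_r dA dB).
  set (M := Rmax (b - a) (d - c)).
  assert (HM1 : b - a <= M) by apply Rmax_l.
  assert (HM2 : d - c <= M) by apply Rmax_r.
  assert (HM3 : M * ((b - a) + (d - c)) <= 2 * ((b - a) ^ 2 + (d - c) ^ 2)).
  { unfold M, Rmax; destruct (Rle_dec (b - a) (d - c)); nra. }
  assert (HdA' : forall u v, a <= u <= b -> c <= v <= d ->
     Rabs (A u v - A x y - (ax * (u - x) + ay * (v - y))) <= eta / 4 * M).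
  { intros u v Hu Hv; eapply Rle_trans; [apply HdA|].
    - apply Rabs_def1; lra.
    - apply Rabs_def1; lra.
    - apply Rmult_le_compat_l; [lra|].
      apply Rmax_lub; apply Rabs_le; lra. }
  assert (HdB' : forall u v, a <= u <= b -> c <= v <= d ->
     Rabs (B u v - B x y - (ay * (u - x) + bx * (v - y))) <= eta / 4 * M).
  { intros u v Hu Hv; eapply Rle_trans; [apply HdB|].
    - apply Rabs_def1; lra.
    - apply Rabs_def1; lra.
    - apply Rmult_le_compat_l; [lra|].
      apply Rmax_lub; apply Rabs_le; lra. }
  assert (H1 : Rabs (RInt (fun x => A x c - A x d) a b - ay * (c - d) * (b - a))
               <= eta / 2 * M * (b - a)).
  { apply RInt_near_const; [lra | |].
    - apply (ex_RInt_minus (V := R_NormedModule));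
      apply (ex_RInt_continuous (V := R_CompleteNormedModule)); intros z Hz;
      rewrite Rmin_left, Rmax_right in Hz by lra; apply Hc; lra.
    - intros u Hu.
      pose proof (HdA' u c Hu ltac:(lra)) as G1; pose proof (HdA' u d Hu ltac:(lra)) as G2.
      apply Rabs_le_between in G1; apply Rabs_le_between in G2; apply Rabs_le; lra. }
  assert (H2 : Rabs (RInt (fun y => B b y - B a y) c d - ay * (b - a) * (d - c))
               <= eta / 2 * M * (d - c)).
  { apply RInt_near_const; [lra | |].
    - apply (ex_RInt_minus (V := R_NormedModule));
      apply (ex_RInt_continuous (V := R_CompleteNormedModule)); intros z Hz;
      rewrite Rmin_left, Rmax_right in Hz by lra; apply Hc; lra.
    - intros v Hv.
      pose proof (HdB' b v ltac:(lra) Hv) as G1; pose proof (HdB' a v ltac:(lra) Hv) as G2.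
      apply Rabs_le_between in G1; apply Rabs_le_between in G2; apply Rabs_le; lra. }
  unfold boundary_integral.
  apply Rabs_le_between in H1; apply Rabs_le_between in H2; apply Rabs_le; nra.
Qed.

(* Goursat's argument: only pointwise differentiability is needed, not
   continuity of the partial derivatives. *)
Lemma goursat_green (A B : R -> R -> R) (a b c d : R) :
  a <= b -> c <= d ->
  (forall x y, a <= x <= b -> c <= y <= d -> exists ax ay bx,
     differentiable_pt_lim A x y ax ay /\ differentiable_pt_lim B x y ay bx) ->
  boundary_integral A B a b c d = 0.
Proof.
  intros Hab Hcd H.
  assert (Hc : forall x y, a <= x <= b -> c <= y <= d ->
     continuous (fun u => A u y) x /\ continuous (fun v => B x v) y).
  { intros x y Hx Hy; destruct (H x y Hx Hy) as (ax & ay & bx & HA & HB); split.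
    - apply (differentiable_pt_lim_continuous A x y ax ay HA).
    - apply (differentiable_pt_lim_continuous B x y ay bx HB). }
  apply NNPP; intros Hne.
  set (J := boundary_integral A B) in *.
  (* Small enough for the whole rectangle to satisfy the strict inequality below; the [+ 1] keeps
     the denominator positive for a degenerate rectangle. *)
  set (eta := Rabs (J a b c d) / (2 * ((b - a) ^ 2 + (d - c) ^ 2) + 1)).
  assert (HD : 0 < 2 * ((b - a) ^ 2 + (d - c) ^ 2) + 1) by nra.
  assert (Heta : 0 < eta).
  { apply Rdiv_lt_0_compat; [apply Rabs_pos_lt; exact Hne | exact HD]. }
  (* Halving both sides divides the sum of squares by 4, so if all four quarters obeyed the opposite
     bound, their sum would obey it too. Containment in the original rectangle is carried along to
     keep continuity available. *)
  destruct (rectangle_bisection (fun p q r s =>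
      ((a <= p /\ q <= b) /\ (c <= r /\ s <= d)) /\
      eta * ((q - p) ^ 2 + (s - r) ^ 2) < Rabs (J p q r s))) with a b c d
    as (x & y & Hx & Hy & Hsm); try assumption.
  - intros p q r s Hpq Hrs [[Hp Hr] HJ].
    assert (E : J p q r s = J p ((p + q) / 2) r ((r + s) / 2) +
       J ((p + q) / 2) q r ((r + s) / 2) +
       (J p ((p + q) / 2) ((r + s) / 2) s + J ((p + q) / 2) q ((r + s) / 2) s)).
    { apply boundary_integral_split; [lra | lra |].
      intros u v Hu Hv; apply Hc; lra. }
    apply NNPP; intros Hno.
    assert (K : forall p' q' r' s', ((a <= p' /\ q' <= b) /\ (c <= r' /\ s' <= d)) ->
       ~ (((a <= p' /\ q' <= b) /\ (c <= r' /\ s' <= d)) /\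
      eta * ((q' - p') ^ 2 + (s' - r') ^ 2) < Rabs (J p' q' r' s')) ->
       Rabs (J p' q' r' s') <= eta * ((q' - p') ^ 2 + (s' - r') ^ 2)).
    { intros p' q' r' s' G1 G2; apply Rnot_lt_le; intros G3; apply G2; tauto. }
    assert (K1 := K p ((p + q) / 2) r ((r + s) / 2) ltac:(lra) ltac:(tauto)).
    assert (K2 := K ((p + q) / 2) q r ((r + s) / 2) ltac:(lra) ltac:(tauto)).
    assert (K3 := K p ((p + q) / 2) ((r + s) / 2) s ltac:(lra) ltac:(tauto)).
    assert (K4 := K ((p + q) / 2) q ((r + s) / 2) s ltac:(lra) ltac:(tauto)).
    rewrite E in HJ.
    pose proof (Rabs_triang (J p ((p + q) / 2) r ((r + s) / 2) +
       J ((p + q) / 2) q r ((r + s) / 2))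
       (J p ((p + q) / 2) ((r + s) / 2) s + J ((p + q) / 2) q ((r + s) / 2) s)).
    pose proof (Rabs_triang (J p ((p + q) / 2) r ((r + s) / 2))
       (J ((p + q) / 2) q r ((r + s) / 2))).
    pose proof (Rabs_triang (J p ((p + q) / 2) ((r + s) / 2) s)
       (J ((p + q) / 2) q ((r + s) / 2) s)).
    nra.
  - split; [lra|].
    assert (E : eta * (2 * ((b - a) ^ 2 + (d - c) ^ 2) + 1) = Rabs (J a b c d))
      by (unfold eta; field; lra).
    rewrite <- E; nra.
  - destruct (H x y Hx Hy) as (ax & ay & bx & HA & HB).
    destruct (boundary_integral_small A B x y ax ay bx eta Heta HA HB) as [e [He Hloc]].
    destruct (Hsm e He) as (p & q & r & s & Hp & Hq & Hr & Hs & Hpq & Hrs & [_ Hbig]).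
    apply Rlt_not_le in Hbig; apply Hbig, Hloc; try lra.
    intros u v Hu Hv; apply Hc; lra.
Qed.

(** * Complex differentiability *)

(* [continuous] and [locally] on [C] are taken for the metric of [Cmod], which
   is the one [is_derive] uses on the side of the variable; the product
   uniform structure of [C] has the same neighbourhoods ([locally_C]). *)
Notation CU := (AbsRing_UniformSpace C_AbsRing).
Notation ccont f z := (@continuous CU CU f z).

(* Caratheodory's formulation: the chain, product and quotient rules become
   rules for continuous functions. *)
Definition cderiv (f : C -> C) (z l : C) : Prop :=
  exists q : C -> C, ccont q z /\ q z = l /\
    @locally CU z (fun y => f y = (f z + q y * (y - z))%C).

Definition cdiff (f : C -> C) (z : C) : Prop := exists l, cderiv f z l.

Lemma locally_Cmod (P : C -> Prop) (z : C) :
  @locally CU z P <-> exists d, 0 < d /\ forall y, Cmod (y - z) < d -> P y.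
Proof.
  split.
  - intros [d Hd]; exists d; split; [apply cond_pos | exact Hd].
  - intros [d [H0 Hd]]; exists (mkposreal d H0); exact Hd.
Qed.

Lemma near_forall (P : C -> Prop) (z : C) : (forall y : C, P y) -> @locally CU z P.
Proof. intros H; apply filter_forall; exact H. Qed.

Lemma near_imp (P Q : C -> Prop) (z : C) :
  (forall y : C, P y -> Q y) -> @locally CU z P -> @locally CU z Q.
Proof. intros H; apply filter_imp; exact H. Qed.

Lemma near_and (P Q : C -> Prop) (z : C) :
  @locally CU z P -> @locally CU z Q -> @locally CU z (fun y => P y /\ Q y).
Proof. apply filter_and. Qed.

Lemma continuous_Cmod {U : UniformSpace} (f : U -> C) (x : U) :
  @continuous U CU f x <->
  forall e, 0 < e -> locally x (fun y => Cmod (f y - f x) < e).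
Proof.
  split.
  - intros H e He; exact (proj1 (filterlim_locally (U := CU) f (f x)) H (mkposreal e He)).
  - intros H; apply (filterlim_locally (U := CU)); intros e; exact (H e (cond_pos e)).
Qed.

Lemma ccont_eps (f : C -> C) (z : C) :
  ccont f z <-> forall e, 0 < e -> exists d, 0 < d /\
    forall y, Cmod (y - z) < d -> Cmod (f y - f z) < e.
Proof.
  rewrite continuous_Cmod; split; intros H e He; apply locally_Cmod, H, He.
Qed.

Lemma ccont_const (c z : C) : ccont (fun _ => c) z.
Proof. apply continuous_const. Qed.

Lemma ccont_id (z : C) : ccont (fun y => y) z.
Proof. apply continuous_id. Qed.

Lemma ccont_plus (f g : C -> C) (z : C) :
  ccont f z -> ccont g z -> ccont (fun y => (f y + g y)%C) z.
Proof. exact (continuous_plus (U := CU) (V := AbsRing_NormedModule C_AbsRing) f g z). Qed.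

Lemma ccont_mult (f g : C -> C) (z : C) :
  ccont f z -> ccont g z -> ccont (fun y => (f y * g y)%C) z.
Proof. exact (continuous_mult (U := CU) (K := C_AbsRing) f g z). Qed.

Lemma ccont_comp (f g : C -> C) (z : C) :
  ccont g z -> ccont f (g z) -> ccont (fun y => f (g y)) z.
Proof. exact (continuous_comp (U := CU) (V := CU) (W := CU) g f z). Qed.

Lemma ccont_minus (f g : C -> C) (z : C) :
  ccont f z -> ccont g z -> ccont (fun y => (f y - g y)%C) z.
Proof.
  intros Hf Hg; apply ccont_plus; [exact Hf|].
  exact (continuous_opp (U := CU) (V := AbsRing_NormedModule C_AbsRing) g z Hg).
Qed.

Lemma Cmod_minus_sym (a b : C) : Cmod (a - b) = Cmod (b - a).
Proof. rewrite <- Cmod_opp; f_equal; ring. Qed.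

Lemma Cmod_triangle_rev (a b : C) : Cmod a - Cmod b <= Cmod (a - b).
Proof.
  pose proof (Cmod_triangle (a - b) b) as H.
  replace (a - b + b)%C with a in H by ring; lra.
Qed.

Lemma ccont_inv (z : C) : z <> 0%C -> ccont Cinv z.
Proof.
  intros Hz; apply ccont_eps; intros e He.
  assert (Hz0 : 0 < Cmod z) by (apply Cmod_gt_0; exact Hz).
  set (m := Cmod z) in *.
  assert (Hem : 0 < e * m) by (apply Rmult_lt_0_compat; assumption).
  exists (Rmin (m / 2) (e * m * m / 2)); split.
  - apply Rmin_pos; nra.
  - intros y Hy.
    assert (Hy1 : Cmod (y - z) < m / 2) by (eapply Rlt_le_trans; [exact Hy | apply Rmin_l]).
    assert (Hy2 : Cmod (y - z) < e * m * m / 2)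
      by (eapply Rlt_le_trans; [exact Hy | apply Rmin_r]).
    assert (Hy3 : m / 2 < Cmod y).
    { pose proof (Cmod_triangle_rev z y) as H; rewrite Cmod_minus_sym in H.
      fold m in H; lra. }
    assert (Hy0 : y <> 0%C) by (apply Cmod_gt_0; lra).
    replace (/ y - / z)%C with ((z - y) / (y * z))%C by (field; auto).
    rewrite Cmod_div by (apply Cmult_neq_0; assumption).
    rewrite Cmod_mult, Cmod_minus_sym; fold m.
    apply Rlt_div_l; nra.
Qed.

Lemma cderiv_cont (f : C -> C) (z l : C) : cderiv f z l -> ccont f z.
Proof.
  intros (q & Hq & _ & H).
  assert (Hc : ccont (fun y => (f z + q y * (y - z))%C) z).
  { apply ccont_plus; [apply ccont_const|].
    apply ccont_mult; [exact Hq|].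
    apply ccont_minus; [apply ccont_id | apply ccont_const]. }
  refine (continuous_ext_loc (T := CU) (U := CU) f _ z _ Hc).
  revert H; apply near_imp; intros y Hy; symmetry; exact Hy.
Qed.

Lemma cderiv_ext_loc (f g : C -> C) (z l : C) :
  @locally CU z (fun y => f y = g y) -> cderiv f z l -> cderiv g z l.
Proof.
  intros He (q & Hq & Hl & H); exists q; split; [exact Hq | split; [exact Hl|]].
  generalize (near_and _ _ _ He H); apply near_imp; intros y [H1 H2].
  rewrite <- H1, <- (locally_singleton (T := CU) z _ He); exact H2.
Qed.

Lemma cderiv_const (c z : C) : cderiv (fun _ => c) z 0.
Proof.
  exists (fun _ => 0%C); split; [apply ccont_const | split; [reflexivity|]].
  apply near_forall; intros y; ring.
Qed.

Lemma cderiv_id (z : C) : cderiv (fun y => y) z 1.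
Proof.
  exists (fun _ => 1%C); split; [apply ccont_const | split; [reflexivity|]].
  apply near_forall; intros y; ring.
Qed.

Lemma cderiv_plus (f g : C -> C) (z l m : C) :
  cderiv f z l -> cderiv g z m -> cderiv (fun y => (f y + g y)%C) z (l + m).
Proof.
  intros (q & Hq & Hl & H) (p & Hp & Hm & H').
  exists (fun y => (q y + p y)%C); split; [apply ccont_plus; assumption|].
  split; [rewrite Hl, Hm; reflexivity|].
  generalize (near_and _ _ _ H H'); apply near_imp; intros y [-> ->]; ring.
Qed.

Lemma cderiv_mult (f g : C -> C) (z l m : C) :
  cderiv f z l -> cderiv g z m ->
  cderiv (fun y => (f y * g y)%C) z (l * g z + f z * m).
Proof.
  intros Hf Hg; pose proof (cderiv_cont _ _ _ Hg) as Hgc.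
  destruct Hf as (q & Hq & Hl & H), Hg as (p & Hp & Hm & H').
  exists (fun y => (q y * g y + f z * p y)%C); split.
  - apply ccont_plus; apply ccont_mult; try assumption; apply ccont_const.
  - split; [rewrite Hl, Hm; reflexivity|].
    generalize (near_and _ _ _ H H'); apply near_imp; intros y [H1 H2].
    rewrite H1.
    replace (f z * g z)%C with (f z * (g y - p y * (y - z)))%C by (rewrite H2; ring).
    ring.
Qed.

Lemma cderiv_comp (f g : C -> C) (z l m : C) :
  cderiv f (g z) l -> cderiv g z m -> cderiv (fun y => f (g y)) z (l * m).
Proof.
  intros Hf Hg; pose proof (cderiv_cont _ _ _ Hg) as Hgc.
  destruct Hf as (q & Hq & Hl & H), Hg as (p & Hp & Hm & H').
  exists (fun y => (q (g y) * p y)%C); split.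
  - apply ccont_mult; [apply ccont_comp; assumption | exact Hp].
  - split; [rewrite Hl, Hm; reflexivity|].
    specialize (Hgc _ H); generalize (near_and _ _ _ Hgc H').
    apply near_imp; intros y [H1 H2].
    rewrite H1.
    replace (g y - g z)%C with (p y * (y - z))%C by (rewrite H2; ring).
    ring.
Qed.

Lemma cderiv_inv (z : C) : z <> 0%C -> cderiv Cinv z (- / (z * z)).
Proof.
  intros Hz; exists (fun y => (- (/ y * / z))%C); split; [|split].
  - apply (continuous_opp (U := CU) (V := AbsRing_NormedModule C_AbsRing)).
    apply ccont_mult; [apply ccont_inv, Hz | apply ccont_const].
  - field; exact Hz.
  - apply locally_Cmod; exists (Cmod z); split; [apply Cmod_gt_0; exact Hz|].
    intros y Hy.
    assert (y <> 0%C).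
    { intros ->; rewrite Cmod_minus_sym in Hy.
      replace (z - 0)%C with z in Hy by ring; lra. }
    field; auto.
Qed.

Lemma cdiff_cont (f : C -> C) (z : C) : cdiff f z -> ccont f z.
Proof. intros [l H]; exact (cderiv_cont f z l H). Qed.

Lemma cdiff_ext_loc (f g : C -> C) (z : C) :
  @locally CU z (fun y => f y = g y) -> cdiff f z -> cdiff g z.
Proof. intros He [l H]; exists l; exact (cderiv_ext_loc f g z l He H). Qed.

Lemma cdiff_const (c z : C) : cdiff (fun _ => c) z.
Proof. eexists; apply cderiv_const. Qed.

Lemma cdiff_id (z : C) : cdiff (fun y => y) z.
Proof. eexists; apply cderiv_id. Qed.

Lemma cdiff_plus (f g : C -> C) (z : C) :
  cdiff f z -> cdiff g z -> cdiff (fun y => (f y + g y)%C) z.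
Proof. intros [l Hl] [m Hm]; eexists; apply cderiv_plus; eassumption. Qed.

Lemma cdiff_mult (f g : C -> C) (z : C) :
  cdiff f z -> cdiff g z -> cdiff (fun y => (f y * g y)%C) z.
Proof. intros [l Hl] [m Hm]; eexists; apply cderiv_mult; eassumption. Qed.

Lemma cdiff_comp (f g : C -> C) (z : C) :
  cdiff f (g z) -> cdiff g z -> cdiff (fun y => f (g y)) z.
Proof. intros [l Hl] [m Hm]; eexists; apply cderiv_comp; eassumption. Qed.

Lemma cdiff_minus (f g : C -> C) (z : C) :
  cdiff f z -> cdiff g z -> cdiff (fun y => (f y - g y)%C) z.
Proof.
  intros Hf Hg; apply (cdiff_ext_loc (fun y => (f y + - (1) * g y)%C)).
  - apply near_forall; intros y; ring.
  - apply cdiff_plus; [exact Hf | apply cdiff_mult; [apply cdiff_const | exact Hg]].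
Qed.

Lemma cdiff_inv (f : C -> C) (z : C) :
  cdiff f z -> f z <> 0%C -> cdiff (fun y => (/ f y)%C) z.
Proof.
  intros Hf H0; apply (cdiff_comp Cinv f); [|exact Hf].
  eexists; apply cderiv_inv, H0.
Qed.

Lemma cdiff_div (f g : C -> C) (z : C) :
  cdiff f z -> cdiff g z -> g z <> 0%C -> cdiff (fun y => (f y / g y)%C) z.
Proof. intros Hf Hg H0; apply cdiff_mult; [exact Hf | apply cdiff_inv; assumption]. Qed.

Lemma cdiff_pow (f : C -> C) (n : nat) (z : C) : cdiff f z -> cdiff (fun y => (f y ^ n)%C) z.
Proof.
  intros Hf; induction n as [|n IH]; simpl; [apply cdiff_const|].
  apply cdiff_mult; assumption.
Qed.

Lemma ccont_pow (f : C -> C) (n : nat) (z : C) : ccont f z -> ccont (fun y => (f y ^ n)%C) z.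
Proof.
  intros Hf; induction n as [|n IH]; simpl; [apply ccont_const|].
  apply ccont_mult; assumption.
Qed.

(** The difference quotient with the value [l] filled in at [a]. For [l] the derivative it is an
    explicit Caratheodory factor, continuous at [a]. *)
Definition quotient (f : C -> C) (a l y : C) : C :=
  if excluded_middle_informative (y = a) then l else ((f y - f a) / (y - a))%C.

Lemma quotient_at (f : C -> C) (a l : C) : quotient f a l a = l.
Proof.
  unfold quotient; destruct (excluded_middle_informative _); [reflexivity | congruence].
Qed.

Lemma quotient_off (f : C -> C) (a l y : C) :
  y <> a -> quotient f a l y = ((f y - f a) / (y - a))%C.
Proof.
  intros H; unfold quotient; destruct (excluded_middle_informative _);
    [contradiction | reflexivity].
Qed.

Lemma Cminus_neq_0 (a b : C) : a <> b -> (a - b)%C <> 0%C.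
Proof.
  intros H E; apply H; replace a with (a - b + b)%C by ring; rewrite E; ring.
Qed.

Lemma quotient_spec (f : C -> C) (a l y : C) :
  f y = (f a + quotient f a l y * (y - a))%C.
Proof.
  destruct (excluded_middle_informative (y = a)) as [-> | H].
  - rewrite quotient_at; ring.
  - rewrite quotient_off by exact H; field; apply Cminus_neq_0, H.
Qed.

Lemma quotient_cont (f : C -> C) (a l : C) : cderiv f a l -> ccont (quotient f a l) a.
Proof.
  intros (q & Hq & Hl & H); refine (continuous_ext_loc (T := CU) (U := CU) _ q a _ Hq).
  revert H; apply near_imp; intros y Hy; change (q y = quotient f a l y).
  destruct (excluded_middle_informative (y = a)) as [-> | H].
  - rewrite quotient_at; exact Hl.
  - rewrite quotient_off by exact H; rewrite Hy; field; apply Cminus_neq_0, H.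
Qed.

Lemma locally_neq (a z : C) : z <> a -> @locally CU z (fun y => y <> a).
Proof.
  intros H; apply locally_Cmod; exists (Cmod (z - a)); split.
  - apply Cmod_gt_0, Cminus_neq_0, H.
  - intros y Hy ->; rewrite Cmod_minus_sym in Hy; lra.
Qed.

Lemma quotient_cdiff (f : C -> C) (a l z : C) :
  z <> a -> cdiff f z -> cdiff (quotient f a l) z.
Proof.
  intros Hz Hf; apply (cdiff_ext_loc (fun y => ((f y - f a) / (y - a))%C)).
  - generalize (locally_neq a z Hz); apply near_imp; intros y Hy; symmetry.
    apply quotient_off, Hy.
  - apply cdiff_div.
    + apply cdiff_minus; [exact Hf | apply cdiff_const].
    + apply cdiff_minus; [apply cdiff_id | apply cdiff_const].
    + apply Cminus_neq_0, Hz.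
Qed.

Lemma cderiv_of_is_derive (f : C -> C) (z l : C) :
  @is_derive C_AbsRing C_NormedModule f z l -> cderiv f z l.
Proof.
  intros [_ H]; exists (quotient f z l); split; [|split].
  - apply continuous_Cmod; intros e He; rewrite quotient_at.
    specialize (H z (fun P HP => HP) (mkposreal (e / 2) ltac:(lra))); simpl in H.
    revert H; apply near_imp; intros y Hy.
    destruct (excluded_middle_informative (y = z)) as [-> | Hyz].
    + rewrite quotient_at; replace (l - l)%C with (RtoC 0) by ring.
      rewrite Cmod_0; exact He.
    + rewrite quotient_off by exact Hyz.
      assert (H0 : 0 < Cmod (y - z)) by (apply Cmod_gt_0, Cminus_neq_0, Hyz).
      change (Cmod (f y - f z - (y - z) * l) <= e / 2 * Cmod (y - z)) in Hy.
      replace ((f y - f z) / (y - z) - l)%C with ((f y - f z - (y - z) * l) / (y - z))%C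
        by (field; apply Cminus_neq_0, Hyz).
      rewrite Cmod_div by (apply Cminus_neq_0, Hyz).
      apply Rlt_div_l; [exact H0 | nra].
  - apply quotient_at.
  - apply near_forall; intros y; apply quotient_spec.
Qed.

Lemma im_le_Cmod (c : C) : Rabs (Im c) <= Cmod c.
Proof.
  eapply Rle_trans; [|apply Rmax_Cmod]; apply Rmax_r.
Qed.

Lemma Cmod_2Rmax' (u v : R) : Cmod (u, v) <= 2 * Rmax (Rabs u) (Rabs v).
Proof.
  eapply Rle_trans; [apply Cmod_2Rmax|]; simpl.
  apply Rmult_le_compat_r; [eapply Rle_trans; [apply Rabs_pos | apply Rmax_l]|].
  pose proof (sqrt_sqrt 2 ltac:(lra)); nra.
Qed.

(** Multiplication by [l] is the real matrix with rows [(Re l, - Im l)] and [(Im l, Re l)]. This is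
    the bridge from complex differentiability to Goursat's theorem for real forms. *)
Lemma cauchy_riemann (f : C -> C) (z l : C) :
  cderiv f z l ->
  differentiable_pt_lim (fun x y => Re (f (x, y))) (Re z) (Im z) (Re l) (- Im l) /\
  differentiable_pt_lim (fun x y => Im (f (x, y))) (Re z) (Im z) (Im l) (Re l).
Proof.
  intros Hf; apply quotient_cont in Hf.
  assert (Hk : forall e : posreal, locally_2d (fun u v =>
     Cmod (f (u, v) - f z - l * ((u, v) - z)) <= e * Rmax (Rabs (u - Re z)) (Rabs (v - Im z)))
     (Re z) (Im z)).
  (* The half compensates for the factor 2 between [Cmod] and the maximum norm of
     [differentiable_pt_lim]. *)
  { intros e; destruct (proj1 (ccont_eps _ _) Hf (e / 2)) as [d [Hd H]].
    { pose proof (cond_pos e); lra. }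
    exists (mkposreal (d / 2) ltac:(lra)); simpl; intros u v Hu Hv.
    assert (Hm : Cmod ((u, v) - z) <= 2 * Rmax (Rabs (u - Re z)) (Rabs (v - Im z))).
    { destruct z as [x y]; apply (Cmod_2Rmax' (u - x) (v - y)). }
    rewrite (quotient_spec f z l (u, v)).
    replace (f z + quotient f z l (u, v) * ((u, v) - z) - f z - l * ((u, v) - z))%C
      with ((quotient f z l (u, v) - l) * ((u, v) - z))%C by ring.
    rewrite Cmod_mult.
    assert (Hlt : Cmod ((u, v) - z) < d).
    { eapply Rle_lt_trans; [exact Hm|]; apply Rmax_case; lra. }
    specialize (H (u, v) Hlt); rewrite quotient_at in H.
    pose proof (Cmod_ge_0 ((u, v) - z)); pose proof (Cmod_ge_0 (quotient f z l (u, v) - l)).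
    nra. }
  destruct z as [x y], l as [a b]; simpl in *.
  split; intros e; destruct (Hk e) as [d Hd]; exists d; intros u v Hu Hv;
    (eapply Rle_trans; [|apply (Hd u v Hu Hv)]).
  - eapply Rle_trans; [|apply re_le_Cmod]; right; f_equal.
    destruct (f (u, v)), (f (x, y)); simpl; ring.
  - eapply Rle_trans; [|apply im_le_Cmod]; right; f_equal.
    destruct (f (u, v)), (f (x, y)); simpl; ring.
Qed.

(** * The maximum principle *)

Definition closed_in_plane (K : C -> Prop) : Prop :=
  forall z, (forall e, 0 < e -> exists y, K y /\ Cmod (y - z) < e) -> K z.

Lemma Cmod_lt_square (x y u v e : R) :
  Rabs (x - u) < e -> Rabs (y - v) < e -> Cmod ((x, y) - (u, v)) < 2 * e.
Proof.
  intros H1 H2.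
  eapply Rle_lt_trans; [apply (Cmod_2Rmax' (x - u) (y - v))|].
  apply Rmult_lt_compat_l; [lra|]; apply Rmax_case; assumption.
Qed.

(* Bisection: the supremum over [K] is always reached over one of the four
   quarters. *)
Lemma attains_max (K : C -> Prop) (w : C -> R) (M : R) :
  (exists z, K z) -> (forall z, K z -> Cmod z <= M) -> closed_in_plane K ->
  (forall z, K z -> @continuous CU R_UniformSpace w z) ->
  exists z, K z /\ forall y, K y -> w y <= w z.
Proof.
  intros [z0 Hz0] HM HK Hw.
  assert (HM0 : 0 <= M) by (specialize (HM _ Hz0); pose proof (Cmod_ge_0 z0); lra).
  destruct (rectangle_bisection (fun a b c d => forall p, K p ->
      exists q, K q /\ a <= Re q <= b /\ c <= Im q <= d /\ w p <= w q)) with (- M) M (- M) M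
    as (x & y & _ & _ & Hsm); try lra.
  - intros a b c d Hab Hcd H.
    apply NNPP; intros Hno.
    assert (Hex : forall a b c d : R, ~ (forall p, K p ->
       exists q, K q /\ a <= Re q <= b /\ c <= Im q <= d /\ w p <= w q) ->
       exists p, K p /\ forall q, K q -> a <= Re q <= b -> c <= Im q <= d -> w q < w p).
    { intros a' b' c' d' Hn; apply NNPP; intros Hn'; apply Hn; intros p Hp.
      apply NNPP; intros Hq; apply Hn'; exists p; split; [exact Hp|].
      intros q H1 H2 H3; apply Rnot_le_lt; intros H4; apply Hq; exists q; tauto. }
    apply not_or_and in Hno; destruct Hno as [N1 Hno].
    apply not_or_and in Hno; destruct Hno as [N2 Hno].
    apply not_or_and in Hno; destruct Hno as [N3 N4].
    apply Hex in N1; apply Hex in N2; apply Hex in N3; apply Hex in N4.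
    destruct N1 as [p1 [K1 N1]], N2 as [p2 [K2 N2]], N3 as [p3 [K3 N3]], N4 as [p4 [K4 N4]].
    (* Each [p1], ..., [p4] beats all points of [K] in its quarter. The best of the four is
       dominated by some [q] of the rectangle, yet [q] lies in a quarter and is beaten there. *)
    assert (Hp : exists p, K p /\ w p1 <= w p /\ w p2 <= w p /\ w p3 <= w p /\ w p4 <= w p).
    { destruct (Rle_lt_dec (w p1) (w p2)), (Rle_lt_dec (w p3) (w p4)).
      - destruct (Rle_lt_dec (w p2) (w p4)); [exists p4 | exists p2]; repeat split; auto; lra.
      - destruct (Rle_lt_dec (w p2) (w p3)); [exists p3 | exists p2]; repeat split; auto; lra.
      - destruct (Rle_lt_dec (w p1) (w p4)); [exists p4 | exists p1]; repeat split; auto; lra.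
      - destruct (Rle_lt_dec (w p1) (w p3)); [exists p3 | exists p1]; repeat split; auto; lra. }
    destruct Hp as (p & Kp & L1 & L2 & L3 & L4).
    destruct (H p Kp) as (q & Kq & Hq1 & Hq2 & Hq3).
    specialize (N1 q Kq); specialize (N2 q Kq); specialize (N3 q Kq); specialize (N4 q Kq).
    destruct (Rle_lt_dec (Re q) ((a + b) / 2)), (Rle_lt_dec (Im q) ((c + d) / 2)).
    + specialize (N1 ltac:(lra) ltac:(lra)); lra.
    + specialize (N3 ltac:(lra) ltac:(lra)); lra.
    + specialize (N2 ltac:(lra) ltac:(lra)); lra.
    + specialize (N4 ltac:(lra) ltac:(lra)); lra.
  - intros p Hp; exists p; specialize (HM p Hp).
    pose proof (re_le_Cmod p) as H1; pose proof (im_le_Cmod p) as H2.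
    apply Rabs_le_between in H1; apply Rabs_le_between in H2.
    repeat split; auto; lra.
  - assert (Hnear : forall e p, 0 < e -> K p -> exists q, K q /\
        Cmod (q - (x, y)) < e /\ w p <= w q).
    { intros e p He Kp.
      destruct (Hsm (e / 2)) as (a & b & c & d & Ha & Hb & Hc & Hd & Hab & Hcd & HP); [lra|].
      destruct (HP p Kp) as (q & Kq & Hq1 & Hq2 & Hq3).
      exists q; split; [exact Kq | split; [|exact Hq3]].
      destruct q as [u v]; simpl in Hq1, Hq2.
      replace e with (2 * (e / 2)) by field.
      apply Cmod_lt_square; apply Rabs_def1; lra. }
    assert (Kz : K (x, y)).
    { apply HK; intros e He; destruct (Hnear e z0 He Hz0) as (q & Kq & Hq & _).
      exists q; tauto. }
    exists (x, y); split; [exact Kz|].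
    intros p Kp; apply Rnot_lt_le; intros Hlt.
    pose proof (proj1 (filterlim_locally (U := R_UniformSpace) w (w (x, y))) (Hw _ Kz)) as Hc.
    specialize (Hc (mkposreal (w p - w (x, y)) ltac:(lra))).
    apply locally_Cmod in Hc; destruct Hc as [d [Hd Hc]].
    destruct (Hnear d p Hd Kp) as (q & Kq & Hq & Hle).
    specialize (Hc q Hq); unfold ball in Hc; simpl in Hc.
    unfold AbsRing_ball, abs, minus, plus, opp in Hc; simpl in Hc.
    apply Rabs_def2 in Hc; lra.
Qed.

Lemma differentiable_pt_lim_fst (f : R -> R) (x y l : R) :
  is_derive f x l -> differentiable_pt_lim (fun u _ => f u) x y l 0.
Proof. intros H; apply differentiable_pt_lim_proj1_0, is_derive_Reals, H. Qed.

Lemma differentiable_pt_lim_snd (f : R -> R) (x y l : R) :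
  is_derive f y l -> differentiable_pt_lim (fun _ v => f v) x y 0 l.
Proof.
  intros H e; destruct (differentiable_pt_lim_fst f y x l H e) as [d Hd].
  exists d; intros u v Hu Hv; specialize (Hd v u Hv Hu).
  rewrite Rmax_comm, Rplus_comm; exact Hd.
Qed.

Lemma differentiable_pt_lim_plus_mult (c x y : R) :
  differentiable_pt_lim (fun u v => c + u * v) x y y x.
Proof.
  intros e; exists e; intros u v Hu Hv.
  replace (c + u * v - (c + x * y) - (y * (u - x) + x * (v - y)))
    with ((u - x) * (v - y)) by ring.
  rewrite Rabs_mult.
  apply Rmult_le_compat; try apply Rabs_pos; [lra | apply Rmax_r].
Qed.

Definition exp_circle (z0 : C) (s t : R) : C := (z0 + polar (exp s) t)%C.

Lemma differentiable_exp_circle_re (z0 : C) (s t : R) :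
  differentiable_pt_lim (fun s t => Re (exp_circle z0 s t)) s t
    (exp s * cos t) (- (exp s * sin t)).
Proof.
  pose proof (differentiable_pt_lim_comp (fun u v => Re z0 + u * v)
    (fun s _ => exp s) (fun _ t => cos t) s t _ _ _ _ _ _
    (differentiable_pt_lim_plus_mult (Re z0) (exp s) (cos t))
    (differentiable_pt_lim_fst exp s t (exp s) (is_derive_exp s))
    (differentiable_pt_lim_snd cos s t (- sin t) (is_derive_cos t))) as H.
  replace (exp s * cos t) with (cos t * exp s + exp s * 0) by ring.
  replace (- (exp s * sin t)) with (cos t * 0 + exp s * - sin t) by ring.
  exact H.
Qed.

Lemma differentiable_exp_circle_im (z0 : C) (s t : R) :
  differentiable_pt_lim (fun s t => Im (exp_circle z0 s t)) s t
    (exp s * sin t) (exp s * cos t).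
Proof.
  pose proof (differentiable_pt_lim_comp (fun u v => Im z0 + u * v)
    (fun s _ => exp s) (fun _ t => sin t) s t _ _ _ _ _ _
    (differentiable_pt_lim_plus_mult (Im z0) (exp s) (sin t))
    (differentiable_pt_lim_fst exp s t (exp s) (is_derive_exp s))
    (differentiable_pt_lim_snd sin s t (cos t) (is_derive_sin t))) as H.
  replace (exp s * sin t) with (sin t * exp s + exp s * 0) by ring.
  replace (exp s * cos t) with (sin t * 0 + exp s * cos t) by ring.
  exact H.
Qed.

Lemma Cmod_polar (r t : R) : 0 <= r -> Cmod (polar r t) = r.
Proof.
  intros Hr; unfold polar, Cmod; simpl.
  rewrite <- (sqrt_Rsqr r Hr); f_equal; unfold Rsqr.
  rewrite (sqrt_square r Hr); pose proof (sin2_cos2 t) as H; unfold Rsqr in H.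
  replace (r * r) with (r * r * (sin t * sin t + cos t * cos t)) by (rewrite H; ring).
  ring.
Qed.

(* Goursat for [f(z) dz / (z - z0)] in the coordinates [z = z0 + e^(s + i t)]:
   the sides [t = 0] and [t = 2 pi] cancel, so the mean over a circle does not
   depend on its radius. *)
Lemma circle_bound_center (f : C -> C) (z0 : C) (r d m : R) :
  0 < r < d -> (forall y, Cmod (y - z0) < d -> cdiff f y) ->
  (forall y, Cmod (y - z0) = r -> Re (f y) <= m) -> Re (f z0) <= m.
Proof.
  intros Hr Hf Hm; apply Rnot_lt_le; intros Hlt.
  assert (Hz0 : cdiff f z0).
  { apply Hf; replace (z0 - z0)%C with (RtoC 0) by ring; rewrite Cmod_0; lra. }
  apply cdiff_cont in Hz0.
  (* Within this distance [Re f] stays above the midpoint of [m] and [Re (f z0)], so the mean over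
     the circle of radius [r1] would exceed the mean over that of radius [r]. *)
  destruct (proj1 (ccont_eps _ _) Hz0 ((Re (f z0) - m) / 2)) as [e [He Hnear]]; [lra|].
  set (r1 := Rmin (e / 2) r).
  assert (Hr1 : 0 < r1) by (apply Rmin_pos; lra).
  assert (Hr1r : r1 <= r) by apply Rmin_r.
  assert (Hr1e : r1 < e) by (pose proof (Rmin_l (e / 2) r); unfold r1; lra).
  pose proof PI_RGT_0 as HPI.
  assert (Hs : ln r1 <= ln r).
  { destruct Hr1r as [H | ->]; [left; apply ln_increasing; assumption | right; reflexivity]. }
  assert (Hdist : forall s t, Cmod (exp_circle z0 s t - z0) = exp s).
  { intros s t; unfold exp_circle.
    replace (z0 + polar (exp s) t - z0)%C with (polar (exp s) t) by ring.
    apply Cmod_polar; left; apply exp_pos. }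
  (* Here [dz / (z - z0) = ds + i dt], so the imaginary part of [f dz / (z - z0)] is
     [Im f ds + Re f dt]. Cauchy-Riemann makes this form closed. *)
  assert (HG : boundary_integral (fun s t => Im (f (exp_circle z0 s t)))
     (fun s t => Re (f (exp_circle z0 s t))) (ln r1) (ln r) 0 (2 * PI) = 0).
  { apply goursat_green; [exact Hs | lra |].
    intros s t Hst _.
    assert (Hexp : exp s <= r).
    { rewrite <- (exp_ln r) by lra.
      destruct (proj2 Hst) as [H | ->]; [left; apply exp_increasing, H | right; reflexivity]. }
    destruct (Hf (exp_circle z0 s t)) as [l Hl]; [rewrite Hdist; lra|].
    destruct (cauchy_riemann _ _ _ Hl) as [H1 H2].
    pose proof (differentiable_pt_lim_comp _ _ _ s t _ _ _ _ _ _ H1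
       (differentiable_exp_circle_re z0 s t) (differentiable_exp_circle_im z0 s t)) as G1.
    pose proof (differentiable_pt_lim_comp _ _ _ s t _ _ _ _ _ _ H2
       (differentiable_exp_circle_re z0 s t) (differentiable_exp_circle_im z0 s t)) as G2.
    assert (EQ : forall u v, (Re (exp_circle z0 u v), Im (exp_circle z0 u v)) = exp_circle z0 u v)
      by (intros u v; destruct (exp_circle z0 u v); reflexivity).
    eexists _, _, _; split.
    - refine (differentiable_pt_lim_ext _ _ _ _ _ _ _ G2).
      exists (mkposreal 1 Rlt_0_1); intros u v _ _; rewrite EQ; reflexivity.
    - replace (Im l * - (exp s * sin t) + Re l * (exp s * cos t))
        with (Re l * (exp s * cos t) + - Im l * (exp s * sin t)) by ring.
      refine (differentiable_pt_lim_ext _ _ _ _ _ _ _ G1).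
      exists (mkposreal 1 Rlt_0_1); intros u v _ _; rewrite EQ; reflexivity. }
  unfold boundary_integral in HG.
  rewrite (RInt_ext _ (fun _ => 0)) in HG.
  2:{ intros s _; unfold exp_circle, polar.
      rewrite cos_2PI, sin_2PI, cos_0, sin_0; apply Rminus_diag. }
  rewrite RInt_const in HG; unfold scal in HG; simpl in HG; unfold mult in HG; simpl in HG.
  assert (Hc : forall s, exp s < d ->
    ex_RInt (fun t => Re (f (exp_circle z0 s t))) 0 (2 * PI)).
  { intros s Hsd; apply (ex_RInt_continuous (V := R_CompleteNormedModule)); intros t _.
    destruct (Hf (exp_circle z0 s t)) as [l Hl]; [rewrite Hdist; lra|].
    destruct (cauchy_riemann _ _ _ Hl) as [H1 _].
    pose proof (differentiable_pt_lim_comp _ _ _ s t _ _ _ _ _ _ H1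
       (differentiable_exp_circle_re z0 s t) (differentiable_exp_circle_im z0 s t)) as G1.
    apply differentiable_pt_lim_continuous in G1; destruct G1 as [_ G1].
    apply (continuous_ext (fun v => Re (f (Re (exp_circle z0 s v), Im (exp_circle z0 s v)))));
      [|exact G1].
    intros v; destruct (exp_circle z0 s v); reflexivity. }
  assert (Hle : RInt (fun t => Re (f (exp_circle z0 (ln r) t)) -
                       Re (f (exp_circle z0 (ln r1) t))) 0 (2 * PI)
              <= RInt (fun _ => - ((Re (f z0) - m) / 2)) 0 (2 * PI)).
  { apply RInt_le; [lra | | apply ex_RInt_const |].
    - apply (ex_RInt_minus (V := R_NormedModule)); apply Hc; rewrite exp_ln by lra; lra.
    - intros t _.
      pose proof (Hm (exp_circle z0 (ln r) t)) as H1; rewrite Hdist, exp_ln in H1 by lra.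
      specialize (H1 eq_refl).
      pose proof (Hnear (exp_circle z0 (ln r1) t)) as H2; rewrite Hdist, exp_ln in H2 by lra.
      specialize (H2 Hr1e).
      pose proof (re_le_Cmod (f (exp_circle z0 (ln r1) t) - f z0)) as H3.
      assert (H4 : Rabs (Re (f (exp_circle z0 (ln r1) t) - f z0)) < (Re (f z0) - m) / 2) by lra.
      apply Rabs_def2 in H4.
      assert (E : Re (f (exp_circle z0 (ln r1) t) - f z0)
              = Re (f (exp_circle z0 (ln r1) t)) - Re (f z0))
        by (destruct (f (exp_circle z0 (ln r1) t)), (f z0); reflexivity).
      rewrite E in H4; lra. }
  rewrite RInt_const in Hle; unfold scal in Hle; simpl in Hle; unfold mult in Hle; simpl in Hle.
  nra.
Qed.

Lemma continuous_Re_comp (f : C -> C) (z : C) :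
  ccont f z -> @continuous CU R_UniformSpace (fun y => Re (f y)) z.
Proof.
  intros H; apply (filterlim_locally (U := R_UniformSpace)); intros e.
  generalize (proj1 (continuous_Cmod (U := CU) f z) H e (cond_pos e)); apply near_imp; intros y Hy.
  eapply Rle_lt_trans; [|exact Hy].
  eapply Rle_trans; [|apply re_le_Cmod]; right; unfold minus, plus, opp, abs; simpl.
  f_equal; destruct (f y), (f z); simpl; ring.
Qed.

Lemma continuous_Cmod_comp (f : C -> C) (z : C) :
  ccont f z -> @continuous CU R_UniformSpace (fun y => Cmod (f y)) z.
Proof.
  intros H; apply (filterlim_locally (U := R_UniformSpace)); intros e.
  generalize (proj1 (continuous_Cmod (U := CU) f z) H e (cond_pos e)); apply near_imp; intros y Hy.
  unfold ball; simpl; unfold AbsRing_ball, minus, plus, opp, abs; simpl.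
  pose proof (Cmod_triangle_rev (f y) (f z)); pose proof (Cmod_triangle_rev (f z) (f y)).
  rewrite (Cmod_minus_sym (f z)) in *.
  apply Rabs_def1; lra.
Qed.

Lemma Cmod_sqr (z : C) : Cmod z * Cmod z = Re z * Re z + Im z * Im z.
Proof. pose proof (Cmod2_alt z); nra. Qed.

(* Perturbing [Re f] by [e |z|^2] makes it strictly subharmonic. *)
Lemma max_principle_Re (K : C -> Prop) (f : C -> C) (M m : R) :
  (forall z, K z -> Cmod z <= M) -> closed_in_plane K -> (forall z, K z -> ccont f z) ->
  (forall z, K z -> Re (f z) <= m \/
     exists d, 0 < d /\ forall y, Cmod (y - z) < d -> K y /\ cdiff f y) ->
  forall z, K z -> Re (f z) <= m.
Proof.
  intros HM HK Hf Hin z1 Kz1; apply Rnot_lt_le; intros Hlt.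
  assert (HM0 : 0 <= M) by (specialize (HM _ Kz1); pose proof (Cmod_ge_0 z1); lra).
  (* The perturbation changes values on [K] by at most [e * M * M], less than the excess
     [Re (f z1) - m]; the perturbed maximum is therefore still at a point with [Re f > m]. *)
  set (e := (Re (f z1) - m) / (1 + M * M)).
  assert (He : 0 < e) by (apply Rdiv_lt_0_compat; nra).
  assert (HeM : e * (1 + M * M) = Re (f z1) - m) by (unfold e; field; nra).
  destruct (attains_max K (fun z => Re (f z) + e * (Cmod z * Cmod z)) M) as [z [Kz Hz]].
  - exists z1; exact Kz1.
  - exact HM.
  - exact HK.
  - intros z Kz.
    apply (continuous_plus (U := CU) (V := R_NormedModule)).
    + apply continuous_Re_comp, Hf, Kz.
    + apply (continuous_mult (U := CU) (K := R_AbsRing)); [apply continuous_const|].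
      apply (continuous_mult (U := CU) (K := R_AbsRing));
        apply (continuous_Cmod_comp (fun y => y)), ccont_id.
  - pose proof (Hz z1 Kz1) as Hz1.
    assert (HMz : Cmod z * Cmod z <= M * M).
    { specialize (HM z Kz); pose proof (Cmod_ge_0 z); nra. }
    assert (Hz1sq : 0 <= Cmod z1 * Cmod z1) by (pose proof (Cmod_ge_0 z1); nra).
    destruct (Hin z Kz) as [H | [d [Hd Hnb]]]; [nra|].
    (* Since [|y|^2 = |y - z|^2 + 2 Re (conj z y) - |z|^2], on a circle around [z] the perturbed
       function is [Re g] plus a constant. Maximality at [z] then puts [Re g] on the circle strictly
       below its value at the centre. *)
    set (g := fun y => (f y + RtoC (2 * e) * Cconj z * y)%C).
    assert (Hg : forall y, Re (g y) = Re (f y) + 2 * e * (Re z * Re y + Im z * Im y)).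
    { intros y; unfold g; generalize (f y) (2 * e); intros [p q] r.
      destruct z, y; simpl; ring. }
    assert (HC : Re (g z) <= Re (g z) - e * (d / 2 * (d / 2))).
    { apply (circle_bound_center g z (d / 2) d); [lra | |].
      - intros y Hy; apply cdiff_plus; [apply Hnb, Hy|].
        apply cdiff_mult; [apply cdiff_const | apply cdiff_id].
      - intros y Hy; rewrite !Hg.
        destruct (Hnb y) as [Ky _]; [lra|].
        specialize (Hz y Ky); rewrite !Cmod_sqr in Hz.
        pose proof (Cmod_sqr (y - z)) as Hd2; rewrite Hy in Hd2.
        replace (Re (y - z)) with (Re y - Re z) in Hd2 by (destruct y, z; reflexivity).
        replace (Im (y - z)) with (Im y - Im z) in Hd2 by (destruct y, z; reflexivity).
        rewrite Hd2; nra. }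
    assert (0 < e * (d / 2 * (d / 2))) by (apply Rmult_lt_0_compat; [exact He | nra]).
    lra.
Qed.

(** A constant [c] of modulus 1 turns the value at the offending point into its modulus, and the
    bound for real parts applies to [c f]. *)
Lemma max_principle (K : C -> Prop) (f : C -> C) (M m : R) :
  (forall z, K z -> Cmod z <= M) -> closed_in_plane K -> (forall z, K z -> ccont f z) ->
  (forall z, K z -> Cmod (f z) <= m \/
     exists d, 0 < d /\ forall y, Cmod (y - z) < d -> K y /\ cdiff f y) ->
  forall z, K z -> Cmod (f z) <= m.
Proof.
  intros HM HK Hf Hin z1 Kz1; apply Rnot_lt_le; intros Hlt.
  (* A zero value has no phase to rotate; but then [m < 0], and the bound on [Re f] itself is
     violated at [z1]. *)
  destruct (Req_dec (Cmod (f z1)) 0) as [H0 | H0].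
  { destruct (Hin z1 Kz1) as [H | [d [Hd Hnb]]]; [lra|].
    assert (Hre : forall z, K z -> Re (f z) <= m \/ 
       exists d, 0 < d /\ forall y, Cmod (y - z) < d -> K y /\ cdiff f y).
    { intros z Kz; destruct (Hin z Kz) as [H | H]; [left | right; exact H].
      pose proof (re_le_Cmod (f z)); pose proof (Rle_abs (Re (f z))); lra. }
    pose proof (max_principle_Re K f M m HM HK Hf Hre z1 Kz1) as H.
    apply Cmod_eq_0 in H0; rewrite H0 in H, Hlt; rewrite Cmod_0 in Hlt; simpl in H; lra. }
  assert (Hpos : 0 < Cmod (f z1)) by (pose proof (Cmod_ge_0 (f z1)); lra).
  set (c := (Cconj (f z1) / RtoC (Cmod (f z1)))%C).
  assert (Hne : RtoC (Cmod (f z1)) <> 0%C) by (intros E; apply H0; injection E; auto).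
  assert (Hc : Cmod c = 1).
  { unfold c; rewrite Cmod_div, Cmod_conj, Cmod_R, Rabs_pos_eq by (try assumption; lra).
    field; lra. }
  assert (Hle : Re (c * f z1)%C <= m).
  { apply (max_principle_Re K (fun z => (c * f z)%C) M m); try assumption.
    - intros z Kz; apply ccont_mult; [apply ccont_const | apply Hf, Kz].
    - intros z Kz; destruct (Hin z Kz) as [H | [d [Hd Hnb]]].
      + left; pose proof (re_le_Cmod (c * f z)) as H1; rewrite Cmod_mult, Hc in H1.
        pose proof (Rle_abs (Re (c * f z))); lra.
      + right; exists d; split; [exact Hd|]; intros y Hy; destruct (Hnb y Hy) as [Ky Dy].
        split; [exact Ky | apply cdiff_mult; [apply cdiff_const | exact Dy]]. }
  assert (E : (c * f z1)%C = RtoC (Cmod (f z1))).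
  { unfold c.
    replace (Cconj (f z1) / Cmod (f z1) * f z1)%C
      with ((f z1 * Cconj (f z1)) / RtoC (Cmod (f z1)))%C by (field; exact Hne).
    rewrite <- Cmod2_conj, RtoC_pow; field; exact Hne. }
  rewrite E in Hle; simpl in Hle; lra.
Qed.

Lemma closed_disc_closed (a : C) (r : R) : closed_in_plane (fun z => Cmod (z - a) <= r).
Proof.
  intros z Hz; apply Rnot_lt_le; intros Hlt.
  destruct (Hz (Cmod (z - a) - r)) as [y [Hy1 Hy2]]; [lra|].
  rewrite Cmod_minus_sym in Hy2.
  pose proof (Cmod_triangle (z - y) (y - a)) as H.
  replace (z - y + (y - a))%C with (z - a)%C in H by ring; lra.
Qed.

Lemma max_principle_disc (f : C -> C) (a : C) (r m : R) :
  (forall z, Cmod (z - a) <= r -> ccont f z) ->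
  (forall z, Cmod (z - a) < r -> cdiff f z) ->
  (forall z, Cmod (z - a) = r -> Cmod (f z) <= m) ->
  forall z, Cmod (z - a) <= r -> Cmod (f z) <= m.
Proof.
  intros Hc Hd Hm; apply (max_principle _ f (Cmod a + r) m).
  - intros z Hz; pose proof (Cmod_triangle (z - a) a) as H.
    replace (z - a + a)%C with z in H by ring; lra.
  - apply closed_disc_closed.
  - exact Hc.
  - intros z [Hz | Hz]; [right | left; apply Hm, Hz].
    exists (r - Cmod (z - a)); split; [lra|]; intros y Hy.
    pose proof (Cmod_triangle (y - z) (z - a)) as H.
    replace (y - z + (z - a))%C with (y - a)%C in H by ring.
    split; [lra | apply Hd; lra].
Qed.

(* An exceptional point [p] is removed by applying the maximum principle to
   [(z - p) f(z)^n], which is differentiable at [p], and letting [n] grow. *)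
Lemma max_principle_disc_except (f : C -> C) (a p : C) (r m : R) :
  0 <= m -> Cmod (p - a) < r ->
  (forall z, Cmod (z - a) <= r -> ccont f z) ->
  (forall z, Cmod (z - a) < r -> z <> p -> cdiff f z) ->
  (forall z, Cmod (z - a) = r -> Cmod (f z) <= m) ->
  forall z, Cmod (z - a) <= r -> Cmod (f z) <= m.
Proof.
  intros Hm0 Hp Hc Hd Hm.
  assert (Hoff : forall z, Cmod (z - a) <= r -> z <> p -> Cmod (f z) <= m).
  { intros z Hz Hzp; apply Rnot_lt_le; intros Hlt.
    assert (Hn : forall n, Cmod (z - p) * Cmod (f z) ^ n <= 2 * r * m ^ n).
    { intros n; rewrite <- Cmod_pow, <- Cmod_mult.
      apply (max_principle_disc (fun z => ((z - p) * f z ^ n)%C) a r); [| | |exact Hz].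
      - intros y Hy; apply ccont_mult.
        + apply ccont_minus; [apply ccont_id | apply ccont_const].
        + apply ccont_pow, Hc, Hy.
      (* At [p] continuity of [f] is enough: [f ^ n] is itself the Caratheodory factor of
         [(z - p) f ^ n]. *)
      - intros y Hy; destruct (excluded_middle_informative (y = p)) as [-> | Hyp].
        + exists (f p ^ n)%C; exists (fun y => (f y ^ n)%C); split; [|split].
          * apply ccont_pow, Hc; lra.
          * reflexivity.
          * apply near_forall; intros y; ring.
        + apply cdiff_mult; [apply cdiff_minus; [apply cdiff_id | apply cdiff_const]|].
          apply cdiff_pow, Hd; assumption.
      - intros y Hy; rewrite Cmod_mult, Cmod_pow.
        apply Rmult_le_compat; [apply Cmod_ge_0 | apply pow_le, Cmod_ge_0 | |].
        + pose proof (Cmod_triangle (y - a) (a - p)) as H.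
          replace (y - a + (a - p))%C with (y - p)%C in H by ring.
          rewrite (Cmod_minus_sym a) in H; lra.
        + apply pow_incr; split; [apply Cmod_ge_0 | apply Hm, Hy]. }
    assert (H0 : 0 < Cmod (z - p)) by (apply Cmod_gt_0, Cminus_neq_0, Hzp).
    set (x := m / Cmod (f z)).
    assert (Hx : Rabs x < 1).
    { unfold x; rewrite Rabs_pos_eq by (apply Rdiv_le_0_compat; lra).
      apply Rlt_div_l; lra. }
    assert (Hr : 0 < r) by (pose proof (Cmod_ge_0 (p - a)); lra).
    destruct (pow_lt_1_zero x Hx (Cmod (z - p) / (2 * r))) as [N HN].
    { apply Rdiv_lt_0_compat; lra. }
    specialize (HN N (Nat.le_refl N)); specialize (Hn N).
    pose proof (Rle_abs (x ^ N)) as Habs.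
    assert (Hpow : 0 < Cmod (f z) ^ N) by (apply pow_lt; lra).
    assert (E : m ^ N = x ^ N * Cmod (f z) ^ N).
    { rewrite <- Rpow_mult_distr; f_equal; unfold x; field; lra. }
    assert (HNx : 2 * r * x ^ N < Cmod (z - p)).
    { apply (Rle_lt_trans _ (2 * r * Rabs (x ^ N))); [nra|].
      replace (Cmod (z - p)) with (2 * r * (Cmod (z - p) / (2 * r))) by (field; lra).
      apply Rmult_lt_compat_l; lra. }
    rewrite E in Hn; nra. }
  intros z Hz; destruct (excluded_middle_informative (z = p)) as [-> | H]; [|apply Hoff; assumption].
  apply Rnot_lt_le; intros Hlt.
  pose proof (Hc p Hz) as Hcp.
  destruct (proj1 (ccont_eps _ _) Hcp (Cmod (f p) - m)) as [d [Hd0 Hnear]]; [lra|].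
  (* The bound at [p] is inherited by continuity from the point [p + h], which is still in the
     disc. *)
  set (h := Rmin (d / 2) ((r - Cmod (p - a)) / 2)).
  assert (Hh : 0 < h) by (apply Rmin_pos; lra).
  assert (Hh1 : h < d) by (pose proof (Rmin_l (d / 2) ((r - Cmod (p - a)) / 2)); unfold h; lra).
  assert (Hh2 : h < r - Cmod (p - a))
    by (pose proof (Rmin_r (d / 2) ((r - Cmod (p - a)) / 2)); unfold h; lra).
  assert (Hmod : Cmod (p + RtoC h - p) = h).
  { replace (p + RtoC h - p)%C with (RtoC h) by ring; rewrite Cmod_R; apply Rabs_pos_eq; lra. }
  specialize (Hnear (p + RtoC h)%C); rewrite Hmod in Hnear; specialize (Hnear Hh1).
  assert (Hle : Cmod (f (p + RtoC h)%C) <= m).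
  { apply Hoff.
    - pose proof (Cmod_triangle (p + RtoC h - p) (p - a)) as H.
      replace (p + RtoC h - p + (p - a))%C with (p + RtoC h - a)%C in H by ring; lra.
    - intros E; rewrite E in Hmod; replace (p - p)%C with (RtoC 0) in Hmod by ring.
      rewrite Cmod_0 in Hmod; lra. }
  rewrite Cmod_minus_sym in Hnear.
  pose proof (Cmod_triangle_rev (f p) (f (p + RtoC h)%C)); lra.
Qed.

(** * Injective holomorphic maps *)

Lemma is_derive_comp_path (f : C -> C) (g1 g2 : R -> R) (t a b : R) (l : C) :
  cderiv f (g1 t, g2 t) l -> is_derive g1 t a -> is_derive g2 t b ->
  is_derive (fun s => Re (f (g1 s, g2 s))) t (Re (l * (a, b))) /\
  is_derive (fun s => Im (f (g1 s, g2 s))) t (Im (l * (a, b))).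
Proof.
  intros Hf Ha Hb; destruct (cauchy_riemann _ _ _ Hf) as [H1 H2].
  apply is_derive_Reals in Ha; apply is_derive_Reals in Hb.
  split; apply is_derive_Reals.
  - pose proof (derivable_pt_lim_comp_2d _ _ _ t _ _ _ _ H1 Ha Hb) as H; simpl in H.
    replace (Re (l * (a, b))) with (Re l * a + - Im l * b)
      by (destruct l; simpl; ring).
    exact H.
  - pose proof (derivable_pt_lim_comp_2d _ _ _ t _ _ _ _ H2 Ha Hb) as H; simpl in H.
    replace (Im (l * (a, b))) with (Im l * a + Re l * b)
      by (destruct l; simpl; ring).
    exact H.
Qed.

Lemma continuity_pt_comp_path (f : C -> C) (g1 g2 : R -> R) (t : R) :
  ccont f (g1 t, g2 t) -> continuity_pt g1 t -> continuity_pt g2 t ->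
  continuity_pt (fun s => Re (f (g1 s, g2 s))) t /\
  continuity_pt (fun s => Im (f (g1 s, g2 s))) t.
Proof.
  intros Hf H1 H2.
  assert (H : forall e, 0 < e -> exists d, 0 < d /\ forall s, Rabs (s - t) < d ->
            Cmod (f (g1 s, g2 s) - f (g1 t, g2 t)) < e).
  { intros e He; destruct (proj1 (ccont_eps _ _) Hf e He) as [d [Hd H]].
    apply continuity_pt_filterlim in H1; apply continuity_pt_filterlim in H2.
    destruct (proj1 (continuous_R_ball _ _) H1 (d / 2)) as [d1 [Hd1 K1]]; [lra|].
    destruct (proj1 (continuous_R_ball _ _) H2 (d / 2)) as [d2 [Hd2 K2]]; [lra|].
    exists (Rmin d1 d2); split; [apply Rmin_pos; assumption|].
    intros s Hs; apply H.
    replace d with (2 * (d / 2)) by field; apply Cmod_lt_square.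
    - apply K1; eapply Rlt_le_trans; [exact Hs | apply Rmin_l].
    - apply K2; eapply Rlt_le_trans; [exact Hs | apply Rmin_r]. }
  split; apply continuity_pt_filterlim, continuous_R_ball; intros e He;
    destruct (H e He) as [d [Hd K]]; exists d; (split; [exact Hd|]); intros s Hs;
    (eapply Rle_lt_trans; [|exact (K s Hs)]).
  - eapply Rle_trans; [|apply re_le_Cmod]; right; f_equal.
  - eapply Rle_trans; [|apply im_le_Cmod]; right; f_equal.
Qed.

Lemma is_derive_affine (p q t : R) : is_derive (fun s => p + s * q) t q.
Proof. auto_derive; [exact I | ring]. Qed.

Lemma segment_eq (a b : C) (t : R) :
  (a + RtoC t * (b - a))%C = (Re a + t * (Re b - Re a), Im a + t * (Im b - Im a)).
Proof. destruct a, b; apply injective_projections; simpl; ring. Qed.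

(** Differentiability is asked only inside the segment because the uniqueness proof applies this to
    a difference quotient on a segment starting at its base point. *)
Lemma segment_constant (f : C -> C) (a b : C) :
  (forall t, 0 <= t <= 1 -> ccont f (a + RtoC t * (b - a))%C) ->
  (forall t, 0 < t < 1 -> cderiv f (a + RtoC t * (b - a))%C 0) -> f b = f a.
Proof.
  intros Hc Hd.
  set (g1 := fun t => Re a + t * (Re b - Re a)).
  set (g2 := fun t => Im a + t * (Im b - Im a)).
  assert (E : forall t, (a + RtoC t * (b - a))%C = (g1 t, g2 t)) by (intros t; apply segment_eq).
  assert (D1 : forall t, is_derive g1 t (Re b - Re a)) by (intros t; apply is_derive_affine).
  assert (D2 : forall t, is_derive g2 t (Im b - Im a)) by (intros t; apply is_derive_affine).
  assert (C1 : forall t, continuity_pt g1 t).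
  { intros t; apply continuity_pt_filterlim, (ex_derive_continuous (V := R_NormedModule)).
    eexists; apply D1. }
  assert (C2 : forall t, continuity_pt g2 t).
  { intros t; apply continuity_pt_filterlim, (ex_derive_continuous (V := R_NormedModule)).
    eexists; apply D2. }
  assert (E0 : a = (g1 0, g2 0)) by (rewrite <- E; ring).
  assert (E1 : b = (g1 1, g2 1)) by (rewrite <- E; ring).
  rewrite E0, E1 at 1.
  apply injective_projections.
  - destruct (MVT_gen (fun s => Re (f (g1 s, g2 s))) 0 1 (fun _ => 0)) as [c [_ H]].
    + rewrite Rmin_left, Rmax_right by lra; intros t Ht; specialize (Hd t Ht).
      rewrite E in Hd.
      destruct (is_derive_comp_path f g1 g2 t _ _ _ Hd (D1 t) (D2 t)) as [H _].
      revert H; match goal with |- is_derive _ _ ?x -> _ => replace x with 0 end;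
        [tauto | simpl; ring].
    + rewrite Rmin_left, Rmax_right by lra; intros t Ht; specialize (Hc t Ht).
      rewrite E in Hc; apply (continuity_pt_comp_path f g1 g2 t Hc (C1 t) (C2 t)).
    + unfold Re in H; lra.
  - destruct (MVT_gen (fun s => Im (f (g1 s, g2 s))) 0 1 (fun _ => 0)) as [c [_ H]].
    + rewrite Rmin_left, Rmax_right by lra; intros t Ht; specialize (Hd t Ht).
      rewrite E in Hd.
      destruct (is_derive_comp_path f g1 g2 t _ _ _ Hd (D1 t) (D2 t)) as [_ H].
      revert H; match goal with |- is_derive _ _ ?x -> _ => replace x with 0 end;
        [tauto | simpl; ring].
    + rewrite Rmin_left, Rmax_right by lra; intros t Ht; specialize (Hc t Ht).
      rewrite E in Hc; apply (continuity_pt_comp_path f g1 g2 t Hc (C1 t) (C2 t)).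
    + unfold Im in H; lra.
Qed.

Definition conformal_pair (Omega : C -> Prop) (f F : C -> C) : Prop :=
  (forall z, Cmod z < 1 -> cdiff f z) /\
  (forall z, Cmod z < 1 -> Omega (f z) /\ F (f z) = z) /\
  (forall w, Omega w -> Cmod (F w) < 1 /\ f (F w) = w).

Lemma conformal_pair_exists (Omega : C -> Prop) (f : C -> C) :
  conformal_onto unit_disc Omega f -> exists F, conformal_pair Omega f F.
Proof.
  intros [Hf [H1 [H2 H3]]].
  set (F := fun w => epsilon (inhabits (RtoC 0)) (fun z => Cmod z < 1 /\ f z = w)).
  assert (HF : forall w, Omega w -> Cmod (F w) < 1 /\ f (F w) = w).
  { intros w Hw; apply (epsilon_spec (inhabits (RtoC 0))), H3, Hw. }
  exists F; split; [|split; [|exact HF]].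
  - intros z Hz; destruct (Hf z Hz) as [l Hl]; exists l; apply cderiv_of_is_derive, Hl.
  - intros z Hz; assert (Hw : Omega (f z)) by apply H1, Hz.
    split; [exact Hw|]; destruct (HF _ Hw) as [G1 G2].
    apply H2; assumption.
Qed.

Lemma conformal_pair_inj (Omega : C -> Prop) (f F : C -> C) (z y : C) :
  conformal_pair Omega f F -> Cmod z < 1 -> Cmod y < 1 -> f z = f y -> z = y.
Proof.
  intros (_ & H & _) Hz Hy E.
  rewrite <- (proj2 (H z Hz)), <- (proj2 (H y Hy)), E; reflexivity.
Qed.

Lemma disc_in_unit_disc (z0 z : C) (r : R) :
  Cmod (z - z0) <= r -> r < 1 - Cmod z0 -> Cmod z < 1.
Proof.
  intros H1 H2; pose proof (Cmod_triangle (z - z0) z0) as H.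
  replace (z - z0 + z0)%C with z in H by ring; lra.
Qed.

(** The distance from [f z] to [f z0] attains its minimum on the circle, and injectivity keeps that
    minimum away from 0. *)
Lemma circle_separation (Omega : C -> Prop) (f F : C -> C) (z0 : C) (r : R) :
  conformal_pair Omega f F -> 0 < r -> r < 1 - Cmod z0 ->
  exists m, 0 < m /\ forall z, Cmod (z - z0) = r -> m <= Cmod (f z - f z0).
Proof.
  intros Hp Hr Hr1.
  assert (Hin : forall z, Cmod (z - z0) = r -> Cmod z < 1).
  { intros z Hz; apply (disc_in_unit_disc z0 z r); lra. }
  assert (Hpt : Cmod (z0 + RtoC r - z0) = r).
  { replace (z0 + RtoC r - z0)%C with (RtoC r) by ring; rewrite Cmod_R; apply Rabs_pos_eq; lra. }
  destruct (attains_max (fun z => Cmod (z - z0) = r) (fun z => - Cmod (f z - f z0)) 1)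
    as [z1 [Hz1 Hmax]].
  - exists (z0 + RtoC r)%C; exact Hpt.
  - intros z Hz; specialize (Hin z Hz); lra.
  - intros z Hz.
    apply NNPP; intros Hne.
    destruct (Hz (Rabs (Cmod (z - z0) - r))) as [y [Hy1 Hy2]]; [apply Rabs_pos_lt; lra|].
    pose proof (Cmod_triangle_rev (z - z0) (y - z0)) as G1.
    pose proof (Cmod_triangle_rev (y - z0) (z - z0)) as G2.
    replace (z - z0 - (y - z0))%C with (z - y)%C in G1 by ring.
    replace (y - z0 - (z - z0))%C with (y - z)%C in G2 by ring.
    rewrite (Cmod_minus_sym z y) in G1.
    revert Hy2; unfold Rabs; destruct (Rcase_abs _); lra.
  - intros z Hz; apply (continuous_opp (U := CU) (V := R_NormedModule)).
    apply (continuous_Cmod_comp (fun z => (f z - f z0)%C)).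
    apply ccont_minus; [|apply ccont_const].
    apply cdiff_cont, Hp, Hin, Hz.
  - exists (Cmod (f z1 - f z0)); split.
    + apply Cmod_gt_0, Cminus_neq_0; intros E.
      apply (conformal_pair_inj _ _ _ _ _ Hp) in E.
      * rewrite E in Hz1; replace (z0 - z0)%C with (RtoC 0) in Hz1 by ring.
        rewrite Cmod_0 in Hz1; lra.
      * apply Hin, Hz1.
      * lra.
    + intros z Hz; specialize (Hmax z Hz); lra.
Qed.

(* If [w] near [f z0] were omitted, [1 / (f - w)] would be larger at [z0] than
   on a circle around [z0]. *)
Lemma open_mapping (Omega : C -> Prop) (f F : C -> C) (z0 : C) (e : R) :
  conformal_pair Omega f F -> Cmod z0 < 1 -> 0 < e ->
  exists d, 0 < d /\ forall w, Cmod (w - f z0) < d ->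
    exists z, Cmod z < 1 /\ Cmod (z - z0) < e /\ f z = w.
Proof.
  intros Hp Hz0 He.
  set (r := Rmin (e / 2) ((1 - Cmod z0) / 2)).
  assert (Hr : 0 < r) by (apply Rmin_pos; lra).
  assert (Hre : r < e) by (pose proof (Rmin_l (e / 2) ((1 - Cmod z0) / 2)); unfold r; lra).
  assert (Hr1 : r < 1 - Cmod z0)
    by (pose proof (Rmin_r (e / 2) ((1 - Cmod z0) / 2)); unfold r; lra).
  destruct (circle_separation Omega f F z0 r Hp Hr Hr1) as [m [Hm Hsep]].
  exists (m / 2); split; [lra|]; intros w Hw.
  apply NNPP; intros Hno.
  assert (Hin : forall z, Cmod (z - z0) <= r -> Cmod z < 1).
  { intros z Hz; apply (disc_in_unit_disc z0 z r); assumption. }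
  assert (Hne : forall z, Cmod (z - z0) <= r -> f z <> w).
  { intros z Hz E; apply Hno; exists z; split; [apply Hin, Hz | split; [lra | exact E]]. }
  assert (Hd : forall z, Cmod (z - z0) <= r -> cdiff (fun z => (/ (f z - w))%C) z).
  { intros z Hz; apply cdiff_inv.
    - apply cdiff_minus; [apply Hp, Hin, Hz | apply cdiff_const].
    - apply Cminus_neq_0, Hne, Hz. }
  assert (Hz : Cmod (z0 - z0) <= r).
  { replace (z0 - z0)%C with (RtoC 0) by ring; rewrite Cmod_0; lra. }
  assert (Hle : Cmod (/ (f z0 - w)) <= / (m / 2)).
  { apply (max_principle_disc (fun z => (/ (f z - w))%C) z0 r); [| | |exact Hz].
    - intros z Hz'; apply cdiff_cont, Hd, Hz'.
    - intros z Hz'; apply Hd; lra.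
    - intros z Hz'; rewrite Cmod_inv by (apply Cminus_neq_0, Hne; lra).
      apply Rinv_le_contravar; [lra|].
      pose proof (Cmod_triangle_rev (f z - f z0) (w - f z0)) as H.
      replace (f z - f z0 - (w - f z0))%C with (f z - w)%C in H by ring.
      specialize (Hsep z Hz'); lra. }
  rewrite Cmod_inv in Hle by (apply Cminus_neq_0, Hne, Hz).
  assert (H0 : 0 < Cmod (f z0 - w)) by (apply Cmod_gt_0, Cminus_neq_0, Hne, Hz).
  rewrite Cmod_minus_sym in Hw; apply Rinv_lt_contravar in Hw; [lra | nra].
Qed.

Lemma inverse_continuous (Omega : C -> Prop) (f F : C -> C) (w : C) :
  conformal_pair Omega f F -> Omega w -> ccont F w.
Proof.
  intros Hp Hw; apply ccont_eps; intros e He.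
  pose proof Hp as (_ & H1 & H2); destruct (H2 w Hw) as [G1 G2].
  destruct (open_mapping Omega f F (F w) e Hp G1 He) as [d [Hd H]].
  rewrite G2 in H; exists d; split; [exact Hd|]; intros y Hy.
  destruct (H y Hy) as (z & Hz1 & Hz2 & <-).
  rewrite (proj2 (H1 z Hz1)); exact Hz2.
Qed.

(* For [p] with [f' p <> 0], the maximum principle applied to
   [(z - p) / (f z - f p)] bounds [1 / f' p] by a constant that is uniform in
   [p] near [z0]. *)
Lemma inverse_lipschitz (Omega : C -> Prop) (f F : C -> C) (z0 : C) :
  conformal_pair Omega f F -> Cmod z0 < 1 ->
  exists B r, 0 < B /\ 0 < r /\ forall p l z, Cmod (p - z0) < r -> Cmod (z - z0) < r ->
    cderiv f p l -> l <> 0%C -> Cmod (z - p) <= B * Cmod (f z - f p).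
Proof.
  intros Hp Hz0.
  set (r := (1 - Cmod z0) / 2).
  assert (Hr : 0 < r) by (unfold r; lra).
  assert (Hr1 : r < 1 - Cmod z0) by (unfold r; lra).
  destruct (circle_separation Omega f F z0 r Hp Hr Hr1) as [m [Hm Hsep]].
  assert (Hin : forall z, Cmod (z - z0) <= r -> Cmod z < 1).
  { intros z Hz; apply (disc_in_unit_disc z0 z r); assumption. }
  pose proof (cdiff_cont _ _ (proj1 Hp z0 Hz0)) as Hc0.
  destruct (proj1 (ccont_eps _ _) Hc0 (m / 2)) as [d [Hd Hnear]]; [lra|].
  (* This is [2 r] divided by [m / 2]: on the circle of radius [r] around [z0], [|y - p| <= 2 r],
     while [|f y - f p| >= m / 2] because [f p] is within [m / 2] of [f z0]. *)
  exists (4 * r / m), (Rmin d r).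
  split; [apply Rdiv_lt_0_compat; lra | split; [apply Rmin_pos; assumption|]].
  intros p l z Hpz Hz Hl Hl0.
  pose proof (Rmin_l d r); pose proof (Rmin_r d r).
  set (q := quotient f p l).
  assert (Hq0 : forall y, Cmod (y - z0) <= r -> q y <> 0%C).
  { intros y Hy E; destruct (excluded_middle_informative (y = p)) as [-> | Hyp].
    - unfold q in E; rewrite quotient_at in E; contradiction.
    - apply Hyp, (conformal_pair_inj _ _ _ _ _ Hp); [apply Hin, Hy | apply Hin; lra|].
      rewrite (quotient_spec f p l y); fold q; rewrite E; ring. }
  assert (Hbound : forall y, Cmod (y - z0) <= r -> Cmod (/ q y) <= 4 * r / m).
  { apply (max_principle_disc_except (fun y => (/ q y)%C) z0 p r).
    - apply Rdiv_le_0_compat; lra.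
    - lra.
    - intros y Hy; apply (ccont_comp Cinv q).
      + destruct (excluded_middle_informative (y = p)) as [-> | Hyp].
        * apply quotient_cont, Hl.
        * apply cdiff_cont, quotient_cdiff; [exact Hyp | apply Hp, Hin, Hy].
      + apply ccont_inv, Hq0, Hy.
    - intros y Hy Hyp; apply cdiff_inv; [|apply Hq0; lra].
      apply quotient_cdiff; [exact Hyp | apply Hp, Hin; lra].
    - intros y Hy.
      assert (Hyp : y <> p) by (intros ->; lra).
      unfold q; rewrite quotient_off by exact Hyp.
      assert (Hm2 : m / 2 <= Cmod (f y - f p)).
      { specialize (Hsep y Hy); specialize (Hnear p ltac:(lra)).
        pose proof (Cmod_triangle_rev (f y - f z0) (f p - f z0)) as HT.
        replace (f y - f z0 - (f p - f z0))%C with (f y - f p)%C in HT by ring; lra. }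
      assert (Hy2 : Cmod (y - p) <= 2 * r).
      { pose proof (Cmod_triangle (y - z0) (z0 - p)) as HT.
        replace (y - z0 + (z0 - p))%C with (y - p)%C in HT by ring.
        rewrite (Cmod_minus_sym z0) in HT; lra. }
      assert (Hfy : (f y - f p)%C <> 0%C) by (apply Cmod_gt_0; lra).
      replace (/ ((f y - f p) / (y - p)))%C with ((y - p) / (f y - f p))%C
        by (field; split; [apply Cminus_neq_0, Hyp | exact Hfy]).
      rewrite Cmod_div by exact Hfy.
      replace (4 * r / m) with (2 * r * / (m / 2)) by (field; lra).
      apply Rmult_le_compat; [apply Cmod_ge_0 | | exact Hy2 |].
      + left; apply Rinv_0_lt_compat; lra.
      + apply Rinv_le_contravar; lra. }
  specialize (Hbound z ltac:(lra)).
  replace (f z - f p)%C with (q z * (z - p))%C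
    by (rewrite (quotient_spec f p l z); fold q; ring).
  rewrite Cmod_mult.
  rewrite Cmod_inv in Hbound by (apply Hq0; lra).
  assert (Hqz : 0 < Cmod (q z)) by (apply Cmod_gt_0, Hq0; lra).
  apply (Rmult_le_compat_r (Cmod (q z))) in Hbound; [|lra].
  rewrite Rinv_l in Hbound by lra.
  pose proof (Cmod_ge_0 (z - p)); nra.
Qed.

(** Suppose the derivative vanishes at [z0]. If it vanishes near [z0], [f] is constant on a segment,
    against injectivity. Otherwise noncritical points [p] accumulate at [z0], and the uniform bound
    [|z - p| <= B |f z - f p|] passes to [z0], where it contradicts the zero derivative. *)
Lemma conformal_deriv_neq_0 (Omega : C -> Prop) (f F : C -> C) (z0 l : C) :
  conformal_pair Omega f F -> Cmod z0 < 1 -> cderiv f z0 l -> l <> 0%C.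
Proof.
  intros Hp Hz0 Hl ->.
  destruct (inverse_lipschitz Omega f F z0 Hp Hz0) as (B & r & HB & Hr & Hlip).
  destruct (classic (exists d, 0 < d /\ forall p, Cmod (p - z0) < d -> cderiv f p 0))
    as [[d [Hd Hconst]] | Hcrit].
  - set (h := Rmin (d / 2) ((1 - Cmod z0) / 2)).
    assert (Hh : 0 < h) by (apply Rmin_pos; lra).
    assert (Hhd : h < d) by (pose proof (Rmin_l (d / 2) ((1 - Cmod z0) / 2)); unfold h; lra).
    assert (Hh1 : h < 1 - Cmod z0)
      by (pose proof (Rmin_r (d / 2) ((1 - Cmod z0) / 2)); unfold h; lra).
    assert (Hmod : forall t, 0 <= t <= 1 ->
      Cmod (z0 + RtoC t * (z0 + RtoC h - z0) - z0) <= h).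
    { intros t Ht; replace (z0 + RtoC t * (z0 + RtoC h - z0) - z0)%C with (RtoC (t * h))
        by (rewrite RtoC_mult; ring).
      rewrite Cmod_R, Rabs_pos_eq; nra. }
    assert (E : f (z0 + RtoC h)%C = f z0).
    { apply segment_constant.
      - intros t Ht; apply (cderiv_cont _ _ 0), Hconst; specialize (Hmod t Ht); lra.
      - intros t Ht; apply Hconst; specialize (Hmod t ltac:(lra)); lra. }
    apply (conformal_pair_inj _ _ _ _ _ Hp) in E; [| |exact Hz0].
    + assert (E' : RtoC h = 0%C)
        by (replace (RtoC h) with (z0 + RtoC h - z0)%C by ring; rewrite E; ring).
      apply RtoC_inj in E'; lra.
    + pose proof (Cmod_triangle z0 (RtoC h)) as HT; rewrite Cmod_R, Rabs_pos_eq in HT; lra.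
  - apply quotient_cont in Hl.
    destruct (proj1 (ccont_eps _ _) Hl (/ (2 * B))) as [d [Hd Hnear]].
    { apply Rinv_0_lt_compat; lra. }
    set (h := Rmin (Rmin (d / 2) (r / 2)) ((1 - Cmod z0) / 2)).
    assert (Hh : 0 < h) by (repeat apply Rmin_pos; lra).
    pose proof (Rmin_l (Rmin (d / 2) (r / 2)) ((1 - Cmod z0) / 2)) as Hm1.
    pose proof (Rmin_r (Rmin (d / 2) (r / 2)) ((1 - Cmod z0) / 2)) as Hm2.
    pose proof (Rmin_l (d / 2) (r / 2)) as Hm3.
    pose proof (Rmin_r (d / 2) (r / 2)) as Hm4.
    fold h in Hm1, Hm2.
    set (y := (z0 + RtoC h)%C).
    assert (Hy : Cmod (y - z0) = h).
    { unfold y; replace (z0 + RtoC h - z0)%C with (RtoC h) by ring.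
      rewrite Cmod_R; apply Rabs_pos_eq; lra. }
    assert (Hfy : Cmod (f y - f z0) <= h / (2 * B)).
    { rewrite (quotient_spec f z0 0 y).
      replace (f z0 + quotient f z0 0 y * (y - z0) - f z0)%C
        with (quotient f z0 0 y * (y - z0))%C by ring.
      specialize (Hnear y ltac:(lra)); rewrite quotient_at in Hnear.
      replace (quotient f z0 0 y - 0)%C with (quotient f z0 0 y) in Hnear by ring.
      rewrite Cmod_mult, Hy; unfold Rdiv; rewrite Rmult_comm.
      apply Rmult_le_compat_l; lra. }
    pose proof (cdiff_cont _ _ (proj1 Hp z0 Hz0)) as Hc0.
    (* For a noncritical [p] within [h / 8] of [z0], the Lipschitz bound would give
       [|y - p| <= h / 2 + h / 8], although [|y - p| > h - h / 8]. *)
    destruct (proj1 (ccont_eps _ _) Hc0 (h / (8 * B))) as [d' [Hd' Hnear']].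
    { apply Rdiv_lt_0_compat; lra. }
    apply Hcrit; exists (Rmin d' (h / 8)); split; [apply Rmin_pos; lra|].
    intros p Hpz; apply NNPP; intros Hp0.
    pose proof (Rmin_l d' (h / 8)); pose proof (Rmin_r d' (h / 8)).
    assert (Hp1 : Cmod p < 1).
    { apply (disc_in_unit_disc z0 p h); lra. }
    destruct (proj1 Hp p Hp1) as [l Hl'].
    assert (Hl0 : l <> 0%C) by (intros ->; contradiction).
    specialize (Hlip p l y ltac:(lra) ltac:(lra) Hl' Hl0).
    specialize (Hnear' p ltac:(lra)).
    pose proof (Cmod_triangle (y - p) (p - z0)) as T1.
    replace (y - p + (p - z0))%C with (y - z0)%C in T1 by ring.
    pose proof (Cmod_triangle (f y - f z0) (f z0 - f p)) as T2.
    replace (f y - f z0 + (f z0 - f p))%C with (f y - f p)%C in T2 by ring.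
    rewrite (Cmod_minus_sym (f z0)) in T2.
    assert (T3 : B * Cmod (f y - f p) <= B * (h / (2 * B) + h / (8 * B)))
      by (apply Rmult_le_compat_l; lra).
    replace (B * (h / (2 * B) + h / (8 * B))) with (h / 2 + h / 8) in T3 by (field; lra).
    lra.
Qed.

(** The reciprocal of the Caratheodory factor of [f], read at [F y], is a factor for [F]. It is
    continuous because [F] is and because [l] is nonzero. *)
Lemma inverse_deriv (Omega : C -> Prop) (f F : C -> C) (w l : C) :
  open Omega -> conformal_pair Omega f F -> Omega w -> cderiv f (F w) l ->
  l <> 0%C /\ cderiv F w (/ l).
Proof.
  intros Ho Hp Hw Hl.
  pose proof Hp as (_ & _ & HF); destruct (HF w Hw) as [G1 G2].
  assert (Hl0 : l <> 0%C) by (apply (conformal_deriv_neq_0 Omega f F (F w)); assumption).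
  split; [exact Hl0|].
  set (q := quotient f (F w) l).
  exists (fun y => (/ q (F y))%C); split; [|split].
  - apply (ccont_comp Cinv (fun y => q (F y))).
    + apply ccont_comp; [apply (inverse_continuous Omega f F w); assumption|].
      apply quotient_cont, Hl.
    + unfold q; rewrite quotient_at; apply ccont_inv, Hl0.
  - unfold q; rewrite quotient_at; reflexivity.
  - pose proof (proj1 (locally_C w Omega) (Ho w Hw)) as Hloc.
    revert Hloc; apply near_imp; intros y Hy.
    destruct (excluded_middle_informative (y = w)) as [-> | Hyw].
    + ring.
    + destruct (HF y Hy) as [K1 K2].
      assert (E : (y - w)%C = (q (F y) * (F y - F w))%C).
      { rewrite <- K2 at 1; rewrite (quotient_spec f (F w) l (F y)), G2; fold q; ring. }
      assert (Hq : q (F y) <> 0%C).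
      { intros E0; apply (Cminus_neq_0 y w Hyw); rewrite E, E0; ring. }
      rewrite E; field; exact Hq.
Qed.

(** * Schwarz lemma and uniqueness of the conformal map *)

Lemma increasing_right (g : R -> R) (t d : R) :
  is_derive g t d -> 0 < d -> exists e, 0 < e /\ forall a, 0 < a < e -> g t < g (t + a).
Proof.
  intros Hg Hd; apply is_derive_Reals in Hg.
  destruct (Hg d Hd) as [e He]; exists e; split; [apply cond_pos|]; intros a Ha.
  specialize (He a ltac:(lra) ltac:(rewrite Rabs_pos_eq; lra)).
  apply Rabs_def2 in He; destruct He as [_ He].
  assert (H : 0 < (g (t + a) - g t) / a) by lra.
  apply (Rmult_lt_compat_r a) in H; [|lra].
  unfold Rdiv in H; rewrite Rmult_assoc, Rinv_l in H by lra; lra.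
Qed.

Lemma deriv_le_0_of_right_max (g : R -> R) (t d e : R) :
  is_derive g t d -> 0 < e -> (forall a, 0 < a < e -> g (t + a) <= g t) -> d <= 0.
Proof.
  intros Hg He H; apply Rnot_lt_le; intros Hd.
  destruct (increasing_right g t d Hg Hd) as [e' [He' H']].
  pose proof (Rmin_l e e'); pose proof (Rmin_r e e').
  assert (0 < Rmin e e') by (apply Rmin_pos; assumption).
  specialize (H (Rmin e e' / 2) ltac:(lra)); specialize (H' (Rmin e e' / 2) ltac:(lra)); lra.
Qed.

(** The limit [r -> 1] of Schwarz-type estimates; [s] is the modulus of the point considered, so
    that the discs of radius [r] contain it. *)
Lemma le_1_of_le_inv (x s : R) : s < 1 -> (forall r, s < r < 1 -> x <= / r) -> x <= 1.
Proof.
  intros Hs H; apply Rnot_lt_le; intros Hx.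
  set (r := (Rmax s (/ x) + 1) / 2).
  assert (H1 : / x < 1) by (rewrite <- Rinv_1; apply Rinv_lt_contravar; lra).
  assert (H2 : 0 < / x) by (apply Rinv_0_lt_compat; lra).
  assert (H3 : Rmax s (/ x) < 1) by (apply Rmax_lub_lt; assumption).
  pose proof (Rmax_l s (/ x)); pose proof (Rmax_r s (/ x)).
  specialize (H r ltac:(unfold r; lra)).
  assert (Hrx : / r < / / x) by (apply Rinv_lt_contravar; unfold r; [nra | lra]).
  rewrite Rinv_inv in Hrx; lra.
Qed.

(** On [|y| = r] the quotient [h y / y] is at most [1 / r]. The origin is the exceptional point of
    the maximum principle, and the case [z = 0] bounds the derivative there. *)
Lemma schwarz (h : C -> C) (l z : C) :
  (forall z, Cmod z < 1 -> cdiff h z /\ Cmod (h z) < 1) -> h 0%C = 0%C -> cderiv h 0 l ->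
  Cmod z < 1 -> Cmod (quotient h 0 l z) <= 1.
Proof.
  intros Hh H0 Hl Hz; apply (le_1_of_le_inv _ (Cmod z)); [exact Hz|]; intros r Hr.
  pose proof (Cmod_ge_0 z) as Hz0.
  assert (Em : forall y, (y - 0)%C = y) by (intros y; ring).
  apply (max_principle_disc_except (quotient h 0 l) 0 0 r).
  - left; apply Rinv_0_lt_compat; lra.
  - rewrite Em, Cmod_0; lra.
  - intros y Hy; rewrite Em in Hy.
    destruct (excluded_middle_informative (y = 0%C)) as [-> | Hy0].
    + apply quotient_cont, Hl.
    + apply cdiff_cont, quotient_cdiff; [exact Hy0 | apply Hh; lra].
  - intros y Hy Hy0; rewrite Em in Hy; apply quotient_cdiff; [exact Hy0 | apply Hh; lra].
  - intros y Hy; rewrite Em in Hy.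
    assert (Hy0 : y <> 0%C) by (apply Cmod_gt_0; lra).
    rewrite quotient_off, H0, !Em, Cmod_div, Hy by exact Hy0.
    unfold Rdiv; rewrite <- (Rmult_1_l (/ r)) at 2.
    apply Rmult_le_compat_r; [left; apply Rinv_0_lt_compat; lra|].
    destruct (Hh y ltac:(lra)); lra.
  - rewrite Em; lra.
Qed.

(** With [m = conj (q z) * l], moving from [z] in the direction [conj m] changes [Re (conj (q z) q)]
    at the rate [|m|^2]. At a maximum this rate cannot be positive. *)
Lemma cderiv_eq_0_of_max (q : C -> C) (z l : C) (d : R) :
  cderiv q z l -> Cmod (q z) = 1 -> 0 < d ->
  (forall y, Cmod (y - z) < d -> Cmod (q y) <= 1) -> l = 0%C.
Proof.
  intros Hl Hz Hd Hmax.
  set (m := (Cconj (q z) * l)%C).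
  assert (Hg : cderiv (fun y => (Cconj (q z) * q y)%C) z m).
  { replace m with (0 * q z + Cconj (q z) * l)%C by (unfold m; ring).
    exact (cderiv_mult (fun _ => Cconj (q z)) q z 0 l (cderiv_const _ _) Hl). }
  set (u := Cconj m).
  set (g1 := fun t => Re z + t * Re u); set (g2 := fun t => Im z + t * Im u).
  assert (E0 : (g1 0, g2 0) = z)
    by (unfold g1, g2; destruct z; apply injective_projections; simpl; ring).
  assert (Hpt : forall t, (g1 t, g2 t) = (z + RtoC t * u)%C).
  { intros t; unfold g1, g2; destruct z, u; apply injective_projections; simpl; ring. }
  assert (Hg' : cderiv (fun y => (Cconj (q z) * q y)%C) (g1 0, g2 0) m) by (rewrite E0; exact Hg).
  destruct (is_derive_comp_path _ g1 g2 0 (Re u) (Im u) m Hg') as [HD _];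
    [apply is_derive_affine | apply is_derive_affine |].
  assert (Em : Re (m * (Re u, Im u)) = Cmod m * Cmod m).
  { rewrite Cmod_sqr; unfold u; destruct m; simpl; ring. }
  rewrite Em in HD.
  assert (Hle : Cmod m * Cmod m <= 0).
  { apply (deriv_le_0_of_right_max _ 0 _ (d / (1 + Cmod m)) HD).
    - apply Rdiv_lt_0_compat; [exact Hd|]; pose proof (Cmod_ge_0 m); lra.
    - intros a Ha; rewrite Rplus_0_l, E0, Hpt.
      assert (H1 : (Cconj (q z) * q z)%C = RtoC 1).
      { rewrite Cmult_comm, <- Cmod2_conj, Hz; f_equal; ring. }
      rewrite H1; change (Re (RtoC 1)) with 1.
      eapply Rle_trans; [apply Rle_abs|]; eapply Rle_trans; [apply re_le_Cmod|].
      rewrite Cmod_mult, Cmod_conj, Hz, Rmult_1_l; apply Hmax.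
      replace (z + RtoC a * u - z)%C with (RtoC a * u)%C by ring.
      unfold u; rewrite Cmod_mult, Cmod_conj, Cmod_R, Rabs_pos_eq by lra.
      pose proof (Cmod_ge_0 m).
      assert (H2 : a * (1 + Cmod m) < d) by (apply Rlt_div_r; lra).
      nra. }
  assert (Hm : Cmod m = 0) by (pose proof (Cmod_ge_0 m); nra).
  unfold m in Hm; rewrite Cmod_mult, Cmod_conj, Hz, Rmult_1_l in Hm; apply Cmod_eq_0, Hm.
Qed.

Lemma conformal_transition (Omega : C -> Prop) (f F g G : C -> C) (c : C) :
  open Omega -> conformal_pair Omega f F -> conformal_pair Omega g G ->
  f 0%C = 0%C -> g 0%C = 0%C -> cderiv f 0 c -> cderiv g 0 c ->
  (forall z, Cmod z < 1 -> cdiff (fun y => F (g y)) z /\ Cmod (F (g z)) < 1) /\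
  F (g 0%C) = 0%C /\ cderiv (fun y => F (g y)) 0 1.
Proof.
  intros Ho Hf Hg Hf0 Hg0 Hfc Hgc.
  assert (Hz : Cmod 0 < 1) by (rewrite Cmod_0; lra).
  pose proof Hf as (Hfd & HfF & HFf); pose proof Hg as (Hgd & HgG & _).
  assert (HF0 : F 0%C = 0%C) by (rewrite <- Hf0 at 1; apply HfF, Hz).
  split; [|split].
  - intros z Hz1; destruct (HgG z Hz1) as [HO _]; destruct (HFf _ HO) as [K1 K2].
    split; [|exact K1]; apply cdiff_comp; [|apply Hgd, Hz1].
    destruct (Hfd _ K1) as [l Hl]; exists (/ l)%C.
    apply (inverse_deriv Omega f F (g z) l); assumption.
  - rewrite Hg0; exact HF0.
  - assert (HO : Omega 0%C) by (rewrite <- Hf0; apply HfF, Hz).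
    rewrite <- HF0 in Hfc.
    destruct (inverse_deriv Omega f F 0 c Ho Hf HO Hfc) as [Hc HF].
    replace (RtoC 1) with (/ c * c)%C by (field; exact Hc).
    apply cderiv_comp; [rewrite Hg0; exact HF | exact Hgc].
Qed.

(** Schwarz's lemma for [h = F o g] and for its inverse [G o f] gives [|h y| = |y|]. So [h y / y]
    has constant modulus 1, its derivative vanishes off 0, and it keeps along the segment from 0 to
    [z] its value 1 at 0. *)
Lemma conformal_unique (Omega : C -> Prop) (f F g G : C -> C) (c z : C) :
  open Omega -> conformal_pair Omega f F -> conformal_pair Omega g G ->
  f 0%C = 0%C -> g 0%C = 0%C -> cderiv f 0 c -> cderiv g 0 c ->
  Cmod z < 1 -> g z = f z.
Proof.
  intros Ho Hf Hg Hf0 Hg0 Hfc Hgc Hz.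
  destruct (excluded_middle_informative (z = 0%C)) as [-> | Hz0]; [congruence|].
  destruct (conformal_transition Omega f F g G c) as (Hh & Hh0 & Hh1); try assumption.
  destruct (conformal_transition Omega g G f F c) as (Hk & Hk0 & Hk1); try assumption.
  set (h := fun y => F (g y)) in *.
  set (q := quotient h 0 1).
  assert (Hq1 : forall y, Cmod y < 1 -> Cmod (q y) <= 1) by (intros y Hy; apply schwarz; assumption).
  assert (Hq2 : forall y, Cmod y < 1 -> Cmod (q y) = 1).
  { intros y Hy; apply Rle_antisym; [apply Hq1, Hy|].
    destruct (excluded_middle_informative (y = 0%C)) as [-> | Hy0].
    { unfold q; rewrite quotient_at, Cmod_1; lra. }
    destruct (Hh y Hy) as [_ Hhy].
    assert (Eq : h y = (q y * y)%C).
    { rewrite (quotient_spec h 0 1 y); fold q; unfold h at 1; rewrite Hh0; ring. }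
    assert (Ek : y = (quotient (fun y => G (f y)) 0 1 (h y) * h y)%C).
    { pose proof (quotient_spec (fun y => G (f y)) 0 1 (h y)) as E; cbv beta in E.
      rewrite Hk0 in E.
      destruct Hf as (_ & _ & HFf), Hg as (_ & HgG & _).
      unfold h at 1 in E; destruct (HgG y Hy) as [HO HG]; rewrite (proj2 (HFf _ HO)), HG in E.
      rewrite E at 1; ring. }
    pose proof (schwarz _ 1 (h y) Hk Hk0 Hk1 Hhy) as Hs.
    assert (H0 : 0 < Cmod y) by (apply Cmod_gt_0, Hy0).
    assert (E1 : Cmod y = Cmod (quotient (fun y => G (f y)) 0 1 (h y)) * (Cmod (q y) * Cmod y))
      by (rewrite Ek at 1; rewrite Cmod_mult; f_equal; rewrite Eq, Cmod_mult; reflexivity).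
    pose proof (Cmod_ge_0 (q y)).
    assert (Hle : Cmod y <= 1 * (Cmod (q y) * Cmod y)).
    { rewrite E1 at 1; apply Rmult_le_compat_r; [nra | exact Hs]. }
    nra. }
  assert (Hqc : forall y, Cmod y < 1 -> ccont q y).
  { intros y Hy; destruct (excluded_middle_informative (y = 0%C)) as [-> | Hy0].
    - apply quotient_cont, Hh1.
    - apply cdiff_cont, quotient_cdiff; [exact Hy0 | apply Hh, Hy]. }
  assert (E : q z = q 0%C).
  { apply segment_constant; intros t Ht;
      replace (0 + RtoC t * (z - 0))%C with (RtoC t * z)%C by ring.
    - apply Hqc; rewrite Cmod_mult, Cmod_R, Rabs_pos_eq by lra; pose proof (Cmod_ge_0 z); nra.
    - assert (Htz : Cmod (RtoC t * z) < 1).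
      { rewrite Cmod_mult, Cmod_R, Rabs_pos_eq by lra; pose proof (Cmod_ge_0 z); nra. }
      assert (Htz0 : (RtoC t * z)%C <> 0%C).
      { apply Cmult_neq_0; [intros Et; apply RtoC_inj in Et; lra | exact Hz0]. }
      destruct (quotient_cdiff h 0 1 _ Htz0 (proj1 (Hh _ Htz))) as [l Hl]; fold q in Hl.
      rewrite <- (cderiv_eq_0_of_max q (RtoC t * z) l (1 - Cmod (RtoC t * z)));
        [exact Hl | exact Hl | apply Hq2, Htz | lra |].
      intros y Hy; apply Hq1.
      pose proof (Cmod_triangle_rev y (RtoC t * z)); lra. }
  unfold q at 2 in E; rewrite quotient_at in E.
  assert (Ehz : F (g z) = z).
  { change (h z = z); rewrite (quotient_spec h 0 1 z); fold q; rewrite E.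
    unfold h; rewrite Hh0; ring. }
  destruct Hf as (_ & _ & HFf), Hg as (_ & HgG & _).
  rewrite <- (proj2 (HFf _ (proj1 (HgG z Hz)))), Ehz; reflexivity.
Qed.

(** * Symmetry of the conformal map about the real axis *)

Lemma ccont_conj (z : C) : ccont Cconj z.
Proof.
  apply ccont_eps; intros e He; exists e; split; [exact He|]; intros y Hy.
  rewrite <- Cminus_conj, Cmod_conj; exact Hy.
Qed.

Lemma cderiv_conj (f : C -> C) (z l : C) :
  cderiv f (Cconj z) l -> cderiv (fun y => Cconj (f (Cconj y))) z (Cconj l).
Proof.
  intros Hf; exists (fun y => Cconj (quotient f (Cconj z) l (Cconj y))); split; [|split].
  - apply (ccont_comp Cconj (fun y => quotient f (Cconj z) l (Cconj y))); [|apply ccont_conj].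
    apply (ccont_comp _ Cconj); [apply ccont_conj | apply quotient_cont, Hf].
  - rewrite quotient_at; reflexivity.
  - apply near_forall; intros y.
    rewrite (quotient_spec f (Cconj z) l (Cconj y)) at 1.
    rewrite Cplus_conj, Cmult_conj, Cminus_conj, !Cconj_conj; reflexivity.
Qed.

Lemma conformal_pair_conj (Omega : C -> Prop) (f F : C -> C) :
  (forall w, Omega w -> Omega (Cconj w)) -> conformal_pair Omega f F ->
  conformal_pair Omega (fun z => Cconj (f (Cconj z))) (fun w => Cconj (F (Cconj w))).
Proof.
  intros HO (H1 & H2 & H3); split; [|split].
  - intros z Hz; rewrite <- Cmod_conj in Hz; destruct (H1 _ Hz) as [l Hl].
    exists (Cconj l); apply cderiv_conj, Hl.
  - intros z Hz; rewrite <- Cmod_conj in Hz; destruct (H2 _ Hz) as [K1 K2].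
    split; [apply HO, K1 | rewrite Cconj_conj, K2, Cconj_conj; reflexivity].
  - intros w Hw; destruct (H3 _ (HO _ Hw)) as [K1 K2].
    rewrite Cmod_conj, Cconj_conj, K2, Cconj_conj; split; [exact K1 | reflexivity].
Qed.

(** The reflected map [conj (f (conj z))] is also conformal onto [Omega], and has the same
    derivative at 0 because [c] is real; uniqueness applies. *)
Lemma conformal_symmetric (Omega : C -> Prop) (f F : C -> C) (c : R) (z : C) :
  open Omega -> (forall w, Omega w -> Omega (Cconj w)) -> conformal_pair Omega f F ->
  f 0%C = 0%C -> cderiv f 0 (RtoC c) -> Cmod z < 1 -> f (Cconj z) = Cconj (f z).
Proof.
  intros Ho HO Hp Hf0 Hc Hz.
  assert (E0 : Cconj 0 = 0%C) by (apply injective_projections; simpl; ring).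
  assert (Ec : Cconj (RtoC c) = RtoC c) by (apply injective_projections; simpl; ring).
  assert (E : Cconj (f (Cconj z)) = f z).
  { apply (conformal_unique Omega f F (fun z => Cconj (f (Cconj z)))
      (fun w => Cconj (F (Cconj w))) (RtoC c)); try assumption.
    - apply conformal_pair_conj; assumption.
    - rewrite E0, Hf0; exact E0.
    - rewrite <- Ec; apply cderiv_conj; rewrite E0; exact Hc. }
  rewrite <- E, Cconj_conj; reflexivity.
Qed.

(** * Circular symmetry *)

(** On a circle about 0, a larger real part means a smaller absolute angle. Equal real parts are
    allowed, so symmetry about the real axis is included. *)
Definition rightward (Omega : C -> Prop) : Prop :=
  forall w w', Cmod w = Cmod w' -> Re w <= Re w' -> Omega w -> Omega w'.

Lemma cos_Rabs (t : R) : cos (Rabs t) = cos t.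
Proof. unfold Rabs; destruct (Rcase_abs t); [apply cos_neg | reflexivity]. Qed.

Lemma polar_exists (w : C) : exists t, Rabs t <= PI /\ w = polar (Cmod w) t.
Proof.
  destruct (Req_dec (Cmod w) 0) as [H0 | H0].
  - exists 0; rewrite Rabs_R0; split; [left; apply PI_RGT_0|].
    rewrite H0; apply Cmod_eq_0 in H0; rewrite H0; unfold polar.
    apply injective_projections; simpl; ring.
  - assert (Hr : 0 < Cmod w) by (pose proof (Cmod_ge_0 w); lra).
    set (r := Cmod w) in *; set (x := Re w / r).
    assert (Hw : r * r = Re w * Re w + Im w * Im w) by apply Cmod_sqr.
    assert (Hx : -1 <= x <= 1).
    { pose proof (re_le_Cmod w) as H; fold r in H; apply Rabs_le_between in H.
      unfold x; split; [apply Rle_div_r | apply Rle_div_l]; lra. }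
    assert (Hrx : r * x = Re w) by (unfold x; field; lra).
    pose proof (acos_bound x) as Hb.
    pose proof (sin_ge_0 (acos x) (proj1 Hb) (proj2 Hb)) as Hs.
    pose proof (sin2_cos2 (acos x)) as Hsc; unfold Rsqr in Hsc.
    rewrite (cos_acos x Hx) in Hsc.
    assert (Hs2 : (r * sin (acos x)) * (r * sin (acos x)) = Im w * Im w).
    { replace (Im w * Im w) with (r * r - (r * x) * (r * x)) by (rewrite Hrx; lra).
      replace (r * sin (acos x) * (r * sin (acos x)))
        with (r * r * (sin (acos x) * sin (acos x))) by ring.
      replace (sin (acos x) * sin (acos x)) with (1 - x * x) by lra; ring. }
    assert (Hrs : 0 <= r * sin (acos x)) by (apply Rmult_le_pos; lra).
    destruct (Rle_lt_dec 0 (Im w)) as [Hi | Hi].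
    + exists (acos x); rewrite Rabs_pos_eq by lra; split; [lra|].
      unfold polar; rewrite (cos_acos x Hx), Hrx.
      apply injective_projections; [reflexivity|]; change (Im w = r * sin (acos x)).
      apply Rsqr_inj; unfold Rsqr; lra.
    + exists (- acos x); rewrite Rabs_Ropp, Rabs_pos_eq by lra; split; [lra|].
      unfold polar; rewrite cos_neg, sin_neg, (cos_acos x Hx), Hrx.
      apply injective_projections; [reflexivity|]; change (Im w = r * - sin (acos x)).
      assert (E : - Im w = r * sin (acos x)) by (apply Rsqr_inj; unfold Rsqr; lra).
      lra.
Qed.

Lemma polar_continuous (r t e : R) :
  0 < e -> exists d, 0 < d /\ forall s, Rabs (s - t) < d -> Cmod (polar r s - polar r t) < e.
Proof.
  intros He.
  assert (C1 : continuous (fun s => r * cos s) t).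
  { apply (ex_derive_continuous (V := R_NormedModule)); auto_derive; exact I. }
  assert (C2 : continuous (fun s => r * sin s) t).
  { apply (ex_derive_continuous (V := R_NormedModule)); auto_derive; exact I. }
  destruct (proj1 (continuous_R_ball _ _) C1 (e / 2)) as [d1 [Hd1 K1]]; [lra|].
  destruct (proj1 (continuous_R_ball _ _) C2 (e / 2)) as [d2 [Hd2 K2]]; [lra|].
  exists (Rmin d1 d2); split; [apply Rmin_pos; assumption|].
  intros s Hs; replace e with (2 * (e / 2)) by field; apply Cmod_lt_square.
  - apply K1; eapply Rlt_le_trans; [exact Hs | apply Rmin_l].
  - apply K2; eapply Rlt_le_trans; [exact Hs | apply Rmin_r].
Qed.

Lemma open_ball (Omega : C -> Prop) (w : C) :
  open Omega -> Omega w -> exists d, 0 < d /\ forall y, Cmod (y - w) < d -> Omega y.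
Proof.
  intros Ho Hw; apply locally_Cmod.
  exact (proj1 (locally_C w Omega) (Ho w Hw)).
Qed.

Lemma open_polar (Omega : C -> Prop) (r t : R) :
  open Omega -> Omega (polar r t) ->
  exists d, 0 < d /\ forall s, Rabs (s - t) < d -> Omega (polar r s).
Proof.
  intros Ho Hw; destruct (open_ball Omega _ Ho Hw) as [e [He HO]].
  destruct (polar_continuous r t e He) as [d [Hd H]].
  exists d; split; [exact Hd|]; intros s Hs; apply HO, H, Hs.
Qed.

Lemma Rabs_le_of_cos_le (s t : R) :
  Rabs s <= PI -> Rabs t <= PI -> cos s <= cos t -> Rabs t <= Rabs s.
Proof.
  intros Hs Ht H; apply Rnot_lt_le; intros Hlt.
  rewrite <- (cos_Rabs s), <- (cos_Rabs t) in H.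
  apply (Rlt_not_le (cos (Rabs s)) (cos (Rabs t))); [|exact H].
  apply cos_decreasing_1; try assumption; apply Rabs_pos.
Qed.

Lemma cos_le_of_Rabs_le (s t : R) :
  Rabs s <= PI -> Rabs t <= Rabs s -> cos s <= cos t.
Proof.
  intros Hs Ht; rewrite <- (cos_Rabs s), <- (cos_Rabs t).
  apply cos_decr_1; try apply Rabs_pos; lra.
Qed.

Lemma rightward_polar (Omega : C -> Prop) (r s t : R) :
  rightward Omega -> 0 <= r -> Rabs s <= PI -> Rabs t <= Rabs s ->
  Omega (polar r s) -> Omega (polar r t).
Proof.
  intros HO Hr Hs Ht; apply HO.
  - rewrite !Cmod_polar by exact Hr; reflexivity.
  - simpl; apply Rmult_le_compat_l; [exact Hr | apply cos_le_of_Rabs_le; assumption].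
Qed.

(** If an endpoint belonged to the open set, so would points of the circle slightly beyond it. As
    [a < PI], these have absolute angle in [(a, PI]] and are not on the arc. *)
Lemma arc_endpoint_not_in_open (Omega : C -> Prop) (r a t : R) (I : R -> Prop) :
  open Omega -> 0 < r -> 0 < a -> a < PI -> (forall t, I t -> - a <= t <= a) ->
  (forall z, Cmod z = r /\ Omega z <-> exists t, I t /\ z = polar r t) ->
  I t -> Rabs t < a.
Proof.
  intros Ho Hr Ha HaP HI HA Ht; apply Rnot_le_lt; intros Hta.
  assert (HO : Omega (polar r t)) by (apply HA; exists t; tauto).
  destruct (open_polar Omega r t Ho HO) as [d [Hd Hs]].
  set (h := Rmin (d / 2) ((PI - a) / 2)).
  assert (Hh : 0 < h) by (apply Rmin_pos; lra).
  assert (Hhd : h < d) by (pose proof (Rmin_l (d / 2) ((PI - a) / 2)); unfold h; lra).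
  assert (HhP : h < PI - a) by (pose proof (Rmin_r (d / 2) ((PI - a) / 2)); unfold h; lra).
  specialize (HI t Ht) as Hti.
  assert (Hex : exists s, Rabs (s - t) < d /\ a < Rabs s /\ Rabs s <= PI).
  { revert Hta; unfold Rabs at 1; destruct (Rcase_abs t); intros Hta.
    - exists (t - h); replace (t - h - t) with (- h) by ring.
      rewrite Rabs_Ropp, Rabs_pos_eq, Rabs_left by lra; lra.
    - exists (t + h); replace (t + h - t) with h by ring.
      rewrite !Rabs_pos_eq by lra; lra. }
  destruct Hex as (s & Hst & Has & HsP).
  assert (Hin : Cmod (polar r s) = r /\ Omega (polar r s))
    by (split; [apply Cmod_polar; lra | apply Hs, Hst]).
  apply HA in Hin; destruct Hin as (s' & Hs' & E).
  specialize (HI s' Hs').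
  assert (Hs'a : Rabs s' <= a) by (apply Rabs_le; lra).
  assert (Ecos : cos s = cos s').
  { injection E; intros _ E1; apply (Rmult_eq_reg_l r); lra. }
  pose proof (Rabs_le_of_cos_le s' s) as H; lra.
Qed.

Lemma circularly_symmetric_rightward (Omega : C -> Prop) :
  open Omega -> circularly_symmetric Omega -> rightward Omega.
Proof.
  intros Ho Hc w w' Hmod Hre Hw.
  destruct (Req_dec (Cmod w) 0) as [H0 | H0].
  { rewrite H0 in Hmod; symmetry in Hmod; apply Cmod_eq_0 in H0; apply Cmod_eq_0 in Hmod.
    rewrite Hmod, <- H0; exact Hw. }
  assert (Hr : 0 < Cmod w) by (pose proof (Cmod_ge_0 w); lra).
  set (r := Cmod w) in *.
  destruct (Hc r Hr) as [H | [H | (a & I & Ha & HI1 & HI2 & HA)]].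
  - exfalso; apply (H w); [reflexivity | exact Hw].
  - apply H; symmetry; exact Hmod.
  - destruct (proj1 (HA w) (conj eq_refl Hw)) as (t & Ht & Ew).
    destruct (polar_exists w') as (t' & Ht' & Ew'); rewrite <- Hmod in Ew'.
    specialize (HI2 t Ht) as Hta.
    assert (Hcos : cos t <= cos t').
    { rewrite Ew, Ew' in Hre; simpl in Hre; apply (Rmult_le_reg_l r); assumption. }
    assert (Htt : Rabs t' <= Rabs t).
    { apply Rabs_le_of_cos_le; try assumption; apply Rabs_le; lra. }
    assert (Hta' : Rabs t <= a) by (apply Rabs_le; lra).
    destruct (Rlt_le_dec (Rabs t') a) as [Hlt | Hge].
    + apply (HA w'); exists t'; split; [|exact Ew'].
      apply HI1; apply Rabs_lt_between in Hlt; exact Hlt.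
    (* Here [|t| = |t'| = a]. For [a < PI] openness excludes an endpoint; for [a = PI] both angles
       give the point [- r]. *)
    + destruct (Rlt_le_dec a PI) as [HaP | HaP].
      { pose proof (arc_endpoint_not_in_open Omega r a t I Ho Hr (proj1 Ha) HaP HI2 HA Ht); lra. }
      replace w' with w; [exact Hw|]; rewrite Ew, Ew'; unfold polar.
      assert (E : forall x, Rabs x = PI -> cos x = -1 /\ sin x = 0).
      { intros x Hx; rewrite <- (cos_Rabs x), Hx, cos_PI; split; [reflexivity|].
        revert Hx; unfold Rabs; destruct (Rcase_abs x); intros Hx.
        - replace x with (- PI) by lra; rewrite sin_neg, sin_PI; ring.
        - rewrite Hx; apply sin_PI. }
      destruct (E t) as [E1 E2]; [lra|]; destruct (E t') as [E3 E4]; [lra|].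
      rewrite E1, E2, E3, E4; reflexivity.
Qed.

Lemma rightward_circularly_symmetric (Omega : C -> Prop) :
  open Omega -> rightward Omega -> circularly_symmetric Omega.
Proof.
  intros Ho HO r Hr.
  destruct (classic (exists w, Cmod w = r /\ Omega w)) as [[w [Hwr Hw]] | Hno].
  2: { left; intros z Hz Hz'; apply Hno; exists z; tauto. }
  (* A circle lying entirely in [Omega] is covered by this case too, with [a = PI]. *)
  right; right.
  pose proof PI_RGT_0 as HPI.
  assert (Hr0 : 0 <= r) by lra.
  assert (H0 : Omega (polar r 0)).
  { apply (HO w); [rewrite Cmod_polar; assumption | | exact Hw].
    simpl; rewrite cos_0, Rmult_1_r, <- Hwr.
    eapply Rle_trans; [apply Rle_abs | apply re_le_Cmod]. }
  set (S := fun s => 0 <= s <= PI /\ Omega (polar r s)).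
  destruct (completeness S) as [a [Ha1 Ha2]].
  { exists PI; intros s [Hs _]; lra. }
  { exists 0; split; [lra | exact H0]. }
  assert (HaP : a <= PI) by (apply Ha2; intros s [Hs _]; lra).
  assert (Ha0 : 0 < a).
  { destruct (open_polar Omega r 0 Ho H0) as [d [Hd Hs]].
    pose proof (Rmin_l (d / 2) PI); pose proof (Rmin_r (d / 2) PI).
    assert (Hm : 0 < Rmin (d / 2) PI) by (apply Rmin_pos; lra).
    apply Rlt_le_trans with (Rmin (d / 2) PI); [exact Hm|].
    apply Ha1; split; [lra|]; apply Hs; rewrite Rminus_0_r, Rabs_pos_eq; lra. }
  exists a, (fun t => Rabs t <= PI /\ Omega (polar r t)).
  split; [lra | split; [|split]].
  - intros t Ht; assert (Hta : Rabs t < a) by (apply Rabs_def1; lra).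
    assert (Hs : exists s, S s /\ Rabs t < s).
    { apply NNPP; intros Hn; apply (Rlt_not_le _ _ Hta), Ha2; intros s Hs.
      apply Rnot_lt_le; intros Hlt; apply Hn; exists s; tauto. }
    destruct Hs as (s & [HsP Hs] & Hts).
    split; [lra|]; apply (rightward_polar Omega r s t); try assumption;
      rewrite (Rabs_pos_eq s) by lra; lra.
  - intros t [Ht1 Ht2]; apply Rabs_le_between, Ha1; split.
    + split; [apply Rabs_pos | exact Ht1].
    + apply (rightward_polar Omega r t); try assumption; rewrite Rabs_Rabsolu; lra.
  - intros z; split.
    + intros [Hz1 Hz2]; destruct (polar_exists z) as (t & Ht & E); rewrite Hz1 in E.
      exists t; rewrite <- E; tauto.
    + intros (t & [Ht1 Ht2] & ->); split; [apply Cmod_polar, Hr0 | exact Ht2].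
Qed.

(** * Monotonicity *)

Lemma closed_sublevel (K : C -> Prop) (f : C -> C) :
  closed_in_plane K -> (forall z, K z -> ccont f z) ->
  closed_in_plane (fun z => K z /\ Re (f z) <= 0).
Proof.
  intros HK Hf z Hz.
  assert (Kz : K z).
  { apply HK; intros e He; destruct (Hz e He) as [y [[Ky _] Hy]]; exists y; tauto. }
  split; [exact Kz|]; apply Rnot_lt_le; intros Hlt.
  destruct (proj1 (ccont_eps _ _) (Hf z Kz) (Re (f z)) Hlt) as [d [Hd H]].
  destruct (Hz d Hd) as [y [[_ Hy] Hyz]]; specialize (H y Hyz).
  pose proof (re_le_Cmod (f y - f z)) as H1.
  assert (H2 : Rabs (Re (f y) - Re (f z)) < Re (f z)).
  { replace (Re (f y) - Re (f z)) with (Re (f y - f z))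
      by (destruct (f y), (f z); reflexivity); lra. }
  apply Rabs_def2 in H2; lra.
Qed.

Lemma same_modulus_same_re (u v : C) :
  Cmod u = Cmod v -> Re u = Re v -> u = v \/ u = Cconj v.
Proof.
  intros Hm Hr.
  assert (Hi : Im u * Im u = Im v * Im v).
  { pose proof (Cmod_sqr u) as H1; pose proof (Cmod_sqr v) as H2.
    rewrite Hm, Hr in H1; lra. }
  assert (H : (Im u - Im v) * (Im u + Im v) = 0) by lra.
  apply Rmult_integral in H; destruct H as [H | H]; [left | right];
    apply injective_projections; simpl; unfold Re, Im in *; lra.
Qed.

(* The maximum principle for [F (c (f z)) / z] on [Re (f z) <= Re (c f z)]:
   where equality holds, [c f z] is [f z] or its conjugate and the quotient has
   modulus 1. *)
Lemma rotation_bound (Omega : C -> Prop) (f F : C -> C) (a : R) (c z : C) :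
  open Omega -> rightward Omega -> conformal_pair Omega f F ->
  (forall z, Cmod z < 1 -> f (Cconj z) = Cconj (f z)) ->
  f 0%C = 0%C -> cderiv f 0 (RtoC a) -> Cmod c = 1 ->
  Cmod z < 1 -> Re (f z) <= Re (c * f z)%C -> Cmod (F (c * f z)%C) <= Cmod z.
Proof.
  intros Ho HO Hp Hsym Hf0 Ha Hc Hz Hre.
  pose proof Hp as (Hfd & HfF & HFf).
  assert (H01 : Cmod 0 < 1) by (rewrite Cmod_0; lra).
  assert (HO0 : Omega 0%C) by (rewrite <- Hf0; apply HfF, H01).
  assert (HF0 : F 0%C = 0%C) by (rewrite <- Hf0 at 1; apply HfF, H01).
  set (H := fun y => F (c * f y)%C).
  assert (Hcf : forall y, Cmod (f y) = Cmod (c * f y)%C)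
    by (intros y; rewrite Cmod_mult, Hc; ring).
  assert (HOr : forall y, Cmod y < 1 -> Re (f y) <= Re (c * f y)%C -> Omega (c * f y)%C).
  { intros y Hy Hle; apply (HO (f y)); [apply Hcf | exact Hle | apply HfF, Hy]. }
  assert (HH0 : H 0%C = 0%C).
  { unfold H; rewrite Hf0; replace (c * 0)%C with (RtoC 0) by ring; exact HF0. }
  assert (HHd : forall y, Cmod y < 1 -> Re (f y) <= Re (c * f y)%C -> cdiff H y).
  { intros y Hy Hle; pose proof (HOr y Hy Hle) as Hw.
    apply (cdiff_comp F (fun y => (c * f y)%C)).
    - destruct (HFf _ Hw) as [K1 _]; destruct (Hfd _ K1) as [l Hl]; exists (/ l)%C.
      apply (inverse_deriv Omega f F _ l); assumption.
    - apply cdiff_mult; [apply cdiff_const | apply Hfd, Hy]. }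
  assert (HH1 : cderiv H 0 c).
  { assert (Ha' : cderiv f (F 0) (RtoC a)) by (rewrite HF0; exact Ha).
    destruct (inverse_deriv Omega f F 0 (RtoC a) Ho Hp HO0 Ha') as [Ha0 HF1].
    replace c with (/ RtoC a * (0 * f 0 + c * RtoC a))%C by (field; exact Ha0).
    apply (cderiv_comp F (fun y => (c * f y)%C)).
    - rewrite Hf0; replace (c * 0)%C with (RtoC 0) by ring; exact HF1.
    - exact (cderiv_mult (fun _ => c) f 0 0 (RtoC a) (cderiv_const _ _) Ha). }
  set (q := quotient H 0 c).
  assert (Hq : forall y, H y = (q y * y)%C).
  { intros y; rewrite (quotient_spec H 0 c y), HH0; fold q; ring. }
  assert (Hqle : Cmod (q z) <= 1).
  { apply (le_1_of_le_inv _ (Cmod z)); [exact Hz|]; intros r Hr.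
    assert (Hr0 : 0 < r) by (pose proof (Cmod_ge_0 z); lra).
    assert (Hr1 : 1 <= / r) by (rewrite <- Rinv_1; apply Rinv_le_contravar; lra).
    assert (Em : forall y, (y - 0)%C = y) by (intros y; ring).
    set (g := fun y => (f y - c * f y)%C).
    assert (Hgc : forall y, Cmod y < 1 -> ccont g y).
    { intros y Hy; apply cdiff_cont, cdiff_minus; [apply Hfd, Hy|].
      apply cdiff_mult; [apply cdiff_const | apply Hfd, Hy]. }
    assert (Hg : forall y, Re (g y) = Re (f y) - Re (c * f y)%C)
      by (intros y; unfold g; destruct (f y), c; simpl; ring).
    apply (max_principle (fun y => Cmod (y - 0) <= r /\ Re (g y) <= 0) q r).
    - intros y [Hy _]; rewrite Em in Hy; exact Hy.
    - apply closed_sublevel; [apply closed_disc_closed|].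
      intros y Hy; rewrite Em in Hy; apply Hgc; lra.
    - intros y [Hy Hle]; rewrite Em in Hy; rewrite Hg in Hle.
      destruct (excluded_middle_informative (y = 0%C)) as [-> | Hy0].
      + apply quotient_cont, HH1.
      + apply cdiff_cont, quotient_cdiff; [exact Hy0 | apply HHd; lra].
    - intros y [Hy Hle]; rewrite Em in Hy; pose proof Hle as Hle'; rewrite Hg in Hle'.
      destruct (excluded_middle_informative (y = 0%C)) as [-> | Hy0].
      (* The origin satisfies the bound outright: the quotient is [c] there and [1 <= / r]. *)
      { left; unfold q; rewrite quotient_at, Hc; exact Hr1. }
      assert (Hy0' : 0 < Cmod y) by (apply Cmod_gt_0, Hy0).
      assert (HqH : Cmod (q y) = Cmod (H y) / Cmod y).
      { rewrite Hq, Cmod_mult; field; lra. }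
      destruct Hy as [Hy | Hy].
      2: { left; rewrite HqH, Hy; unfold Rdiv; rewrite <- (Rmult_1_l (/ r)) at 2.
           apply Rmult_le_compat_r; [left; apply Rinv_0_lt_compat, Hr0|].
           left; apply HFf, HOr; lra. }
      destruct Hle as [Hle | Hle].
      + right; pose proof (Hgc y ltac:(lra)) as Hgy.
        destruct (proj1 (ccont_eps _ _) Hgy (- Re (g y))) as [d [Hd Hnear]]; [lra|].
        assert (Hlt : forall x, Cmod (x - y) < d -> Re (g x) < 0).
        { intros x Hx; specialize (Hnear x Hx).
          pose proof (re_le_Cmod (g x - g y)) as H1.
          replace (Re (g x - g y)) with (Re (g x) - Re (g y)) in H1
            by (destruct (g x), (g y); reflexivity).
          assert (H2 : Rabs (Re (g x) - Re (g y)) < - Re (g y)) by lra.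
          apply Rabs_def2 in H2; lra. }
        exists (Rmin d (r - Cmod y)); split; [apply Rmin_pos; lra|].
        intros x Hx; pose proof (Rmin_l d (r - Cmod y)); pose proof (Rmin_r d (r - Cmod y)).
        specialize (Hlt x ltac:(lra)).
        pose proof (Cmod_triangle_rev x y).
        (* As [Re (g 0) = 0], a neighbourhood on which [Re g < 0] avoids the origin, the only point
           where [q] is not known to be differentiable. *)
        assert (Hx0 : x <> 0%C).
        { intros ->; rewrite Hg, Hf0 in Hlt; revert Hlt; destruct c; simpl; lra. }
        split; [rewrite Em; lra|].
        rewrite Hg in Hlt; apply quotient_cdiff; [exact Hx0 | apply HHd; lra].
      + left; rewrite Hg in Hle; rewrite HqH.
        assert (E : Cmod (H y) = Cmod y).
        { assert (Hy1 : Cmod y < 1) by lra.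
          destruct (same_modulus_same_re (c * f y)%C (f y)) as [E | E];
            [rewrite <- Hcf; reflexivity | lra | |]; unfold H; rewrite E.
          - rewrite (proj2 (HfF y Hy1)); reflexivity.
          - rewrite <- Hsym by exact Hy1.
            rewrite <- (Cmod_conj y); f_equal; apply HfF; rewrite Cmod_conj; exact Hy1. }
        rewrite E; unfold Rdiv; rewrite Rinv_r; lra.
    - split; [rewrite Em; lra | rewrite Hg; lra]. }
  change (Cmod (H z) <= Cmod z); rewrite Hq, Cmod_mult.
  pose proof (Cmod_ge_0 z); nra.
Qed.

(** * Derivatives of squared moduli along circles, and the upper half plane *)

Lemma is_derive_Cmod2_path (f : C -> C) (g1 g2 : R -> R) (t a b : R) (l : C) :
  cderiv f (g1 t, g2 t) l -> is_derive g1 t a -> is_derive g2 t b ->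
  is_derive (fun s => Cmod (f (g1 s, g2 s)) * Cmod (f (g1 s, g2 s))) t
    (2 * Re (Cconj (f (g1 t, g2 t)) * (l * (a, b)))).
Proof.
  intros Hl Ha Hb.
  destruct (is_derive_comp_path f g1 g2 t a b l Hl Ha Hb) as [H1 H2].
  apply (is_derive_ext (fun s => Re (f (g1 s, g2 s)) * Re (f (g1 s, g2 s)) +
                                 Im (f (g1 s, g2 s)) * Im (f (g1 s, g2 s)))).
  - intros s; symmetry; apply Cmod_sqr.
  - pose proof (is_derive_plus _ _ _ _ _
      (is_derive_mult _ _ _ _ _ H1 H1 Rmult_comm)
      (is_derive_mult _ _ _ _ _ H2 H2 Rmult_comm)) as H.
    match type of H with is_derive _ _ ?d =>
      replace (2 * Re (Cconj (f (g1 t, g2 t)) * (l * (a, b)))) with d end; [exact H|].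
    unfold plus, mult; simpl; unfold mult; simpl; destruct (f (g1 t, g2 t)), l; simpl; ring.
Qed.

Lemma is_derive_polar_re (r t : R) : is_derive (fun s => r * cos s) t (- (r * sin t)).
Proof. auto_derive; [exact I | ring]. Qed.

Lemma is_derive_polar_im (r t : R) : is_derive (fun s => r * sin s) t (r * cos t).
Proof. auto_derive; [exact I | ring]. Qed.

(** The velocity of the circle at [z] is [i z], and [2 Re (conj (f z) l i z) = - 2 Im (z l conj (f
    z))]. The square of the modulus is used since it stays differentiable at zeros of [f]. *)
Lemma is_derive_Cmod2_polar (f : C -> C) (r t : R) (l : C) :
  cderiv f (polar r t) l ->
  is_derive (fun s => Cmod (f (polar r s)) * Cmod (f (polar r s))) t
    (- 2 * Im (polar r t * l * Cconj (f (polar r t)))).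
Proof.
  intros Hl.
  pose proof (is_derive_Cmod2_path f (fun s => r * cos s) (fun s => r * sin s) t _ _ l Hl
    (is_derive_polar_re r t) (is_derive_polar_im r t)) as H.
  match type of H with is_derive _ _ ?d =>
    replace (- 2 * Im (polar r t * l * Cconj (f (polar r t)))) with d end; [exact H|].
  unfold polar; destruct (f (r * cos t, r * sin t)), l; simpl; ring.
Qed.

(** For [w = f z] and [l = f' z], the left side carries the angular derivative of [|F|^2] at [w] and
    the right side that of [|f|^2] at [z]: they have opposite signs. *)
Lemma Im_conj_quotient (z l w : C) :
  l <> 0%C -> Im (w * / l * Cconj z) * (Cmod l * Cmod l) = - Im (z * l * Cconj w).
Proof.
  intros Hl.
  assert (E : (w * / l * Cconj z * RtoC (Cmod l * Cmod l))%C = Cconj (z * l * Cconj w)).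
  { replace (RtoC (Cmod l * Cmod l)) with (l * Cconj l)%C
      by (rewrite <- Cmod2_conj; f_equal; ring).
    rewrite !Cmult_conj, Cconj_conj; field; exact Hl. }
  rewrite <- im_conj, <- E.
  generalize (w * / l * Cconj z)%C (Cmod l * Cmod l); intros [u v] x; simpl; ring.
Qed.

Definition preserves_upper (f : C -> C) : Prop :=
  forall z, Cmod z < 1 -> 0 < Im z -> 0 < Im (f z).

(** Along the radius to [z], [Im (f (t z))] starts positive because its derivative at 0 is
    [c * Im z]. It never vanishes afterwards: a real value would be shared by [t z] and its
    conjugate, against injectivity. *)
Lemma symmetric_preserves_upper (Omega : C -> Prop) (f F : C -> C) (c : R) :
  conformal_pair Omega f F ->
  (forall z, Cmod z < 1 -> f (Cconj z) = Cconj (f z)) ->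
  0 < c -> f 0%C = 0%C -> cderiv f 0 (RtoC c) -> preserves_upper f.
Proof.
  intros Hp Hsym Hc Hf0 Hd z Hz Hi.
  set (g1 := fun t => t * Re z); set (g2 := fun t => t * Im z).
  assert (E : forall t, (g1 t, g2 t) = (RtoC t * z)%C).
  { intros t; unfold g1, g2; destruct z; apply injective_projections; simpl; ring. }
  assert (D1 : forall t, is_derive g1 t (Re z)) by (intros t; unfold g1; auto_derive; [exact I | ring]).
  assert (D2 : forall t, is_derive g2 t (Im z)) by (intros t; unfold g2; auto_derive; [exact I | ring]).
  assert (Hin : forall t, 0 <= t <= 1 -> Cmod (RtoC t * z) < 1).
  { intros t Ht; rewrite Cmod_mult, Cmod_R, Rabs_pos_eq by lra; pose proof (Cmod_ge_0 z); nra. }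
  set (psi := fun t => Im (f (g1 t, g2 t))).
  assert (E0 : (g1 0, g2 0) = RtoC 0) by (rewrite E; apply Cmult_0_l).
  assert (Hpsi0 : psi 0 = 0) by (unfold psi; rewrite E0, Hf0; reflexivity).
  assert (Hne : forall t, 0 < t <= 1 -> psi t <> 0).
  { intros t Ht H0; unfold psi in H0; rewrite E in H0.
    assert (Ht1 : Cmod (RtoC t * z) < 1) by (apply Hin; lra).
    assert (Ec : f (Cconj (RtoC t * z)) = f (RtoC t * z)%C).
    { rewrite Hsym by exact Ht1; revert H0; destruct (f (RtoC t * z)%C) as [u v]; simpl.
      intros ->; apply injective_projections; simpl; ring. }
    apply (conformal_pair_inj _ _ _ _ _ Hp) in Ec; [|rewrite Cmod_conj; exact Ht1 | exact Ht1].
    apply (f_equal Im) in Ec; rewrite im_conj in Ec.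
    assert (Em : Im (RtoC t * z) = t * Im z) by (destruct z; simpl; ring).
    rewrite Em in Ec; nra. }
  assert (Hd0 : cderiv f (g1 0, g2 0) (RtoC c)) by (rewrite E0; exact Hd).
  destruct (is_derive_comp_path f g1 g2 0 _ _ _ Hd0 (D1 0) (D2 0)) as [_ HD].
  fold psi in HD.
  destruct (increasing_right psi 0 _ HD) as [e [He Hinc]].
  { destruct z; simpl in *; nra. }
  pose proof (Rmin_l e 1); pose proof (Rmin_r e 1).
  assert (Hm : 0 < Rmin e 1) by (apply Rmin_pos; lra).
  set (t0 := Rmin e 1 / 2).
  specialize (Hinc t0 ltac:(unfold t0; lra)); rewrite Rplus_0_l, Hpsi0 in Hinc.
  assert (E1 : psi 1 = Im (f z)).
  { unfold psi; rewrite E; f_equal; f_equal; ring. }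
  rewrite <- E1; apply Rnot_le_lt; intros Hle.
  assert (Hlt : psi 1 < 0).
  { destruct Hle as [H' | H']; [exact H' | exfalso; apply (Hne 1); [lra | exact H']]. }
  destruct (Ranalysis5.IVT_interv (fun t => - psi t) t0 1) as [t [Ht Hroot]].
  - intros t Ht; apply continuity_pt_opp.
    apply (continuity_pt_comp_path f g1 g2 t).
    + rewrite E; apply cdiff_cont, Hp, Hin; unfold t0 in Ht; lra.
    + apply continuity_pt_filterlim, (ex_derive_continuous (V := R_NormedModule)).
      eexists; apply D1.
    + apply continuity_pt_filterlim, (ex_derive_continuous (V := R_NormedModule)).
      eexists; apply D2.
  - unfold t0; lra.
  - lra.
  - lra.
  - apply (Hne t); [unfold t0 in Ht; lra | lra].
Qed.

Lemma reflects_upper (f : C -> C) (z : C) :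
  (forall z, Cmod z < 1 -> f (Cconj z) = Cconj (f z)) -> preserves_upper f ->
  Cmod z < 1 -> 0 < Im (f z) -> 0 < Im z.
Proof.
  intros Hsym Hup Hz Hi; apply Rnot_le_lt; intros [Hlt | H0].
  - specialize (Hup (Cconj z)); rewrite Cmod_conj, Hsym, !im_conj in Hup by exact Hz.
    specialize (Hup Hz ltac:(lra)); lra.
  - assert (E : Cconj z = z).
    { destruct z; simpl in H0; apply injective_projections; simpl; lra. }
    specialize (Hsym z Hz); rewrite E in Hsym; apply (f_equal Im) in Hsym.
    rewrite im_conj in Hsym; lra.
Qed.

(* The imaginary part has the sign of [Im (z f'(z) / f z)]. *)
Definition im_nonneg_upper (f : C -> C) : Prop :=
  forall z l, Cmod z < 1 -> 0 < Im z -> cderiv f z l -> 0 <= Im (z * l * Cconj (f z)).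

(** Turning [w = f z] clockwise moves it to the right, since [Im w > 0]; by [rotation_bound] this
    does not increase [|F|]. The derivative of [|F|^2] at the start is thus at most 0, and its sign
    is carried over to [f]. *)
Lemma rightward_im_nonneg (Omega : C -> Prop) (f F : C -> C) (a : R) :
  open Omega -> rightward Omega -> conformal_pair Omega f F ->
  (forall z, Cmod z < 1 -> f (Cconj z) = Cconj (f z)) ->
  0 < a -> f 0%C = 0%C -> cderiv f 0 (RtoC a) -> im_nonneg_upper f.
Proof.
  intros Ho HO Hp Hsym Ha Hf0 Hd z l Hz Hi Hl.
  pose proof (symmetric_preserves_upper Omega f F a Hp Hsym Ha Hf0 Hd z Hz Hi) as Hw.
  pose proof Hp as (_ & HfF & _); destruct (HfF z Hz) as [HOw HFw].
  set (w := f z) in *.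
  assert (Hl' : cderiv f (F w) l) by (rewrite HFw; exact Hl).
  destruct (inverse_deriv Omega f F w l Ho Hp HOw Hl') as [Hl0 HF].
  (* The path [(g1 s, g2 s)] is [w] turned clockwise by [s], with initial velocity [- i w]. *)
  set (g1 := fun s => Re w * cos s + Im w * sin s).
  set (g2 := fun s => Im w * cos s - Re w * sin s).
  assert (D1 : is_derive g1 0 (Im w)).
  { unfold g1; auto_derive; [exact I|]; rewrite sin_0, cos_0; ring. }
  assert (D2 : is_derive g2 0 (- Re w)).
  { unfold g2; auto_derive; [exact I|]; rewrite sin_0, cos_0; ring. }
  assert (E0 : (g1 0, g2 0) = w).
  { unfold g1, g2; rewrite sin_0, cos_0; destruct w; apply injective_projections; simpl; ring. }
  assert (Eg : forall s, (g1 s, g2 s) = (polar 1 (- s) * w)%C).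
  { intros s; unfold g1, g2, polar; rewrite cos_neg, sin_neg.
    destruct w; apply injective_projections; simpl; ring. }
  destruct (increasing_right g1 0 _ D1 Hw) as [e [He Hinc]].
  assert (HF0 : cderiv F (g1 0, g2 0) (/ l)) by (rewrite E0; exact HF).
  pose proof (is_derive_Cmod2_path F g1 g2 0 _ _ _ HF0 D1 D2) as HD.
  assert (Hle : 2 * Re (Cconj (F (g1 0, g2 0)) * (/ l * (Im w, - Re w))) <= 0).
  { apply (deriv_le_0_of_right_max _ 0 _ e HD He); intros s Hs.
    specialize (Hinc s Hs); rewrite Rplus_0_l in *.
    rewrite E0, HFw, Eg.
    assert (Hb : Cmod (F (polar 1 (- s) * w)%C) <= Cmod z).
    { apply (rotation_bound Omega f F a (polar 1 (- s)) z); try assumption.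
      - apply Cmod_polar; lra.
      - fold w; rewrite <- Eg; change (Re w <= g1 s).
        assert (E1 : g1 0 = Re w) by (unfold g1; rewrite sin_0, cos_0; ring); lra. }
    pose proof (Cmod_ge_0 (F (polar 1 (- s) * w)%C)); apply Rmult_le_compat; assumption. }
  rewrite E0, HFw in Hle.
  pose proof (Im_conj_quotient z l w Hl0) as HI.
  assert (E : Re (Cconj z * (/ l * (Im w, - Re w))) = Im (w * / l * Cconj z)).
  { destruct w, z, (/ l)%C; simpl; ring. }
  rewrite E in Hle.
  assert (0 < Cmod l * Cmod l).
  { assert (0 < Cmod l) by (apply Cmod_gt_0, Hl0); nra. }
  nra.
Qed.

Lemma nonneg_sqr_le (x y : R) : 0 <= x -> 0 <= y -> x * x <= y * y -> x <= y.
Proof. intros Hx Hy H; apply Rnot_lt_le; intros Hlt; nra. Qed.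

Lemma polar_path_continuity_pt (f : C -> C) (r t : R) :
  ccont f (polar r t) ->
  continuity_pt (fun s => Cmod (f (polar r s)) * Cmod (f (polar r s))) t.
Proof.
  intros Hf.
  destruct (continuity_pt_comp_path f (fun s => r * cos s) (fun s => r * sin s) t Hf) as [H1 H2].
  - apply continuity_pt_filterlim.
    apply (ex_derive_continuous (V := R_NormedModule) (fun s => r * cos s)).
    eexists; apply is_derive_polar_re.
  - apply continuity_pt_filterlim.
    apply (ex_derive_continuous (V := R_NormedModule) (fun s => r * sin s)).
    eexists; apply is_derive_polar_im.
  - apply (continuity_pt_ext (fun s => Re (f (polar r s)) * Re (f (polar r s)) +
                                       Im (f (polar r s)) * Im (f (polar r s)))).
    + intros s; symmetry; apply Cmod_sqr.
    + apply continuity_pt_plus; apply continuity_pt_mult; assumption.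
Qed.

Lemma im_nonneg_decreasing (f : C -> C) (r : R) :
  (forall z, Cmod z < 1 -> cdiff f z) -> im_nonneg_upper f -> 0 < r < 1 ->
  decreasing_on 0 PI (fun t => Cmod (f (polar r t))).
Proof.
  intros Hf Him Hr s t Hs Hst Ht.
  assert (Hin : forall t, Cmod (polar r t) < 1) by (intros x; rewrite Cmod_polar; lra).
  apply nonneg_sqr_le; [apply Cmod_ge_0 | apply Cmod_ge_0|].
  set (psi := fun x => Cmod (f (polar r x)) * Cmod (f (polar r x))).
  set (dpsi := fun x => - 2 * Im (polar r x * epsilon (inhabits (RtoC 0)) (cderiv f (polar r x)) *
                                  Cconj (f (polar r x)))).
  assert (HD : forall x, cderiv f (polar r x)
            (epsilon (inhabits (RtoC 0)) (cderiv f (polar r x)))).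
  { intros x; apply epsilon_spec, Hf, Hin. }
  destruct (Rle_lt_or_eq_dec s t Hst) as [Hlt | ->]; [|lra].
  (* The mean value point is interior, so [sin c > 0] even when [s = 0] or [t = PI]: the real axis,
     where [im_nonneg_upper] gives no sign, is avoided. *)
  destruct (MVT_cor2 psi dpsi s t Hlt) as [c [Hc1 Hc2]].
  - intros c Hc; apply is_derive_Reals, is_derive_Cmod2_polar, HD.
  - assert (Hc0 : dpsi c <= 0).
    { assert (0 <= Im (polar r c * epsilon (inhabits (RtoC 0)) (cderiv f (polar r c)) *
                                  Cconj (f (polar r c)))).
      { apply Him; [apply Hin | | apply HD].
        simpl; apply Rmult_lt_0_compat; [lra | apply sin_gt_0; lra]. }
      unfold dpsi; lra. }
    fold (psi s) (psi t).
    change (psi t <= psi s); nra.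
Qed.

Lemma polar_exists_upper (z : C) : 0 < Im z -> exists t, 0 < t < PI /\ z = polar (Cmod z) t.
Proof.
  intros Hi; destruct (polar_exists z) as (t & Ht & E).
  assert (Hr : 0 < Cmod z).
  { apply Cmod_gt_0; intros ->; simpl in Hi; lra. }
  exists t; split; [|exact E].
  apply Rabs_le_between in Ht.
  assert (Es : Im z = Cmod z * sin t) by (rewrite E at 1; reflexivity).
  assert (Hs : 0 < sin t) by (apply (Rmult_lt_reg_l (Cmod z)); lra).
  split.
  - apply Rnot_le_lt; intros Hle.
    pose proof (sin_ge_0 (- t)) as H; rewrite sin_neg in H; lra.
  - destruct (Req_dec t PI) as [-> | Hne]; [rewrite sin_PI in Hs; lra | lra].
Qed.

Lemma decreasing_im_nonneg (f : C -> C) :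
  (forall r, 0 < r < 1 -> decreasing_on 0 PI (fun t => Cmod (f (polar r t)))) ->
  im_nonneg_upper f.
Proof.
  intros Hdec z l Hz Hi Hl.
  destruct (polar_exists_upper z Hi) as (t & Ht & E).
  assert (Hr : 0 < Cmod z).
  { apply Cmod_gt_0; intros ->; simpl in Hi; lra. }
  set (r := Cmod z) in *.
  assert (Hl' : cderiv f (polar r t) l) by (rewrite <- E; exact Hl).
  pose proof (is_derive_Cmod2_polar f r t l Hl') as HD.
  apply (deriv_le_0_of_right_max _ t _ (PI - t)) in HD; [| lra |].
  - rewrite <- E in HD; lra.
  - intros a Ha.
    pose proof (Hdec r ltac:(lra) t (t + a) ltac:(lra) ltac:(lra) ltac:(lra)) as Hle.
    cbv beta in Hle; pose proof (Cmod_ge_0 (f (polar r (t + a)))).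
    apply Rmult_le_compat; assumption.
Qed.

(** The distance from [f z] to [w] attains its minimum on the closed disc; since it takes
    arbitrarily small values, that minimum is 0 and [w] is a value of [f]. *)
Lemma image_of_disc_closed (Omega : C -> Prop) (f F : C -> C) (R0 : R) (w : C) :
  conformal_pair Omega f F -> 0 <= R0 < 1 ->
  (forall e, 0 < e -> exists z, Cmod z <= R0 /\ Cmod (f z - w) < e) -> Omega w.
Proof.
  intros Hp HR Hw.
  assert (Em : forall y, (y - 0)%C = y) by (intros y; ring).
  destruct (attains_max (fun z => Cmod (z - 0) <= R0) (fun z => - Cmod (f z - w)) R0)
    as [z [Hz Hmax]].
  - exists 0%C; rewrite Em, Cmod_0; lra.
  - intros z Hz; rewrite Em in Hz; exact Hz.
  - apply closed_disc_closed.
  - intros z Hz; rewrite Em in Hz.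
    apply (continuous_opp (U := CU) (V := R_NormedModule)).
    apply (continuous_Cmod_comp (fun z => (f z - w)%C)).
    apply ccont_minus; [apply cdiff_cont, Hp; lra | apply ccont_const].
  - rewrite Em in Hz.
    assert (E : f z = w).
    { apply NNPP; intros Hne.
      destruct (Hw (Cmod (f z - w))) as [y [Hy1 Hy2]]; [apply Cmod_gt_0, Cminus_neq_0, Hne|].
      specialize (Hmax y); rewrite Em in Hmax; specialize (Hmax Hy1); lra. }
    rewrite <- E; apply Hp; lra.
Qed.

Lemma inverse_monotone_on_arc (Omega : C -> Prop) (f F : C -> C) (r s t : R) :
  open Omega -> conformal_pair Omega f F ->
  (forall z, Cmod z < 1 -> f (Cconj z) = Cconj (f z)) ->
  preserves_upper f -> im_nonneg_upper f ->
  0 < r -> 0 <= s <= t -> t <= PI -> (forall x, s <= x <= t -> Omega (polar r x)) ->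
  Cmod (F (polar r s)) <= Cmod (F (polar r t)).
Proof.
  intros Ho Hp Hsym Hup Him Hr Hst Ht HO.
  pose proof Hp as (Hfd & HfF & HFf).
  apply nonneg_sqr_le; [apply Cmod_ge_0 | apply Cmod_ge_0|].
  destruct (Rle_lt_or_eq_dec s t (proj2 Hst)) as [Hlt | ->]; [|lra].
  set (psi := fun x => Cmod (F (polar r x)) * Cmod (F (polar r x))).
  set (L := fun x => epsilon (inhabits (RtoC 0)) (cderiv f (F (polar r x)))).
  assert (HL : forall x, s <= x <= t -> cderiv f (F (polar r x)) (L x)).
  { intros x Hx; apply epsilon_spec, Hfd, HFf, HO, Hx. }
  assert (Hpos : forall x, s < x < t -> 0 <= - 2 * Im (polar r x * / L x * Cconj (F (polar r x)))).
  { intros x Hx.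
    assert (HOx : Omega (polar r x)) by (apply HO; lra).
    destruct (HFf _ HOx) as [HF1 HF2].
    assert (HLx : cderiv f (F (polar r x)) (L x)) by (apply HL; lra).
    destruct (inverse_deriv Omega f F _ _ Ho Hp HOx HLx) as [Hl0 _].
    assert (HFi : 0 < Im (F (polar r x))).
    { apply (reflects_upper f); try assumption.
      rewrite HF2; simpl; apply Rmult_lt_0_compat; [exact Hr | apply sin_gt_0; lra]. }
    pose proof (Him _ _ HF1 HFi HLx) as HT; rewrite HF2 in HT.
    pose proof (Im_conj_quotient (F (polar r x)) (L x) (polar r x) Hl0) as HI.
    assert (0 < Cmod (L x) * Cmod (L x)).
    { assert (0 < Cmod (L x)) by (apply Cmod_gt_0, Hl0); nra. }
    nra. }
  (* The mean value point may be an endpoint here, where the sign of the formula is unknown. The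
     maximum with 0 changes nothing on the open interval and is nonnegative everywhere. *)
  destruct (MVT_gen psi s t
      (fun x => Rmax 0 (- 2 * Im (polar r x * / L x * Cconj (F (polar r x))))))
    as [c [_ E]].
  - rewrite Rmin_left, Rmax_right by lra; intros x Hx.
    rewrite Rmax_right by (apply Hpos, Hx).
    apply is_derive_Cmod2_polar.
    apply (inverse_deriv Omega f F (polar r x) (L x)); try assumption; [apply HO | apply HL]; lra.
  - rewrite Rmin_left, Rmax_right by lra; intros x Hx.
    apply polar_path_continuity_pt, (inverse_continuous Omega f F); [exact Hp | apply HO, Hx].
  - match type of E with _ = Rmax 0 ?x * _ => pose proof (Rmax_l 0 x) end.
    change (psi s <= psi t); nra.
Qed.

Lemma arc_towards_positive_axis (Omega : C -> Prop) (f F : C -> C) (r s t : R) :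
  open Omega -> conformal_pair Omega f F ->
  (forall z, Cmod z < 1 -> f (Cconj z) = Cconj (f z)) ->
  preserves_upper f -> im_nonneg_upper f ->
  0 < r -> 0 <= s <= t -> t <= PI -> Omega (polar r t) -> Omega (polar r s).
Proof.
  intros Ho Hp Hsym Hup Him Hr Hst Ht HOt.
  apply NNPP; intros Hno.
  (* [u] is the last angle before [t] at which the arc is outside [Omega]. Openness puts [polar r u]
     itself outside, whereas the monotonicity of [|F|] on [(u, t]] will make it a limit of points of
     [f] of a smaller closed disc. *)
  destruct (completeness (fun x => x <= t /\ ~ Omega (polar r x))) as [u [Hu1 Hu2]].
  { exists t; intros x [Hx _]; exact Hx. }
  { exists s; split; [apply Hst | exact Hno]. }
  assert (Hsu : s <= u) by (apply Hu1; split; [apply Hst | exact Hno]).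
  assert (Hut : u <= t) by (apply Hu2; intros x [Hx _]; exact Hx).
  assert (Habove : forall x, u < x <= t -> Omega (polar r x)).
  { intros x Hx; apply NNPP; intros Hx'; specialize (Hu1 x (conj (proj2 Hx) Hx')); lra. }
  assert (Hu : ~ Omega (polar r u)).
  { intros HOu; destruct (open_polar Omega r u Ho HOu) as [d [Hd Hnear]].
    assert (Hle : u <= u - d); [|lra].
    apply Hu2; intros x [Hx Hx'].
    pose proof (Hu1 x (conj Hx Hx')) as Hxu.
    apply Rnot_lt_le; intros Hlt; apply Hx', Hnear, Rabs_def1; lra. }
  assert (Hut' : u < t).
  { destruct Hut as [H | ->]; [exact H | contradiction]. }
  pose proof Hp as (_ & _ & HFf).
  apply Hu, (image_of_disc_closed Omega f F (Cmod (F (polar r t)))); [exact Hp | |].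
  { split; [apply Cmod_ge_0 | apply HFf, HOt]. }
  intros e He; destruct (polar_continuous r u e He) as [d [Hd Hnear]].
  set (x := u + Rmin (d / 2) (t - u)).
  pose proof (Rmin_l (d / 2) (t - u)); pose proof (Rmin_r (d / 2) (t - u)).
  assert (Hm : 0 < Rmin (d / 2) (t - u)) by (apply Rmin_pos; lra).
  assert (HOx : Omega (polar r x)) by (apply Habove; unfold x; lra).
  exists (F (polar r x)); split.
  - apply (inverse_monotone_on_arc Omega f F r x t); try assumption; [unfold x; lra |].
    intros y Hy; apply Habove; unfold x in Hy; lra.
  - rewrite (proj2 (HFf _ HOx)); apply Hnear; unfold x.
    apply Rabs_def1; lra.
Qed.

Lemma symmetric_im_nonneg_rightward (Omega : C -> Prop) (f F : C -> C) :
  open Omega -> conformal_pair Omega f F ->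
  (forall z, Cmod z < 1 -> f (Cconj z) = Cconj (f z)) ->
  preserves_upper f -> im_nonneg_upper f -> rightward Omega.
Proof.
  intros Ho Hp Hsym Hup Him w w' Hmod Hre Hw.
  assert (Hconj : forall v, Omega v -> Omega (Cconj v)).
  { intros v Hv; destruct Hp as (_ & HfF & HFf); destruct (HFf v Hv) as [K1 K2].
    rewrite <- K2, <- Hsym by exact K1; apply HfF; rewrite Cmod_conj; exact K1. }
  (* Symmetry reduces the claim to angles in [[0, PI]], where the arc argument applies. *)
  assert (Habs : forall r t, Omega (polar r t) <-> Omega (polar r (Rabs t))).
  { intros r t; unfold Rabs; destruct (Rcase_abs t); [|tauto].
    assert (E : polar r (- t) = Cconj (polar r t)).
    { unfold polar; rewrite cos_neg, sin_neg; apply injective_projections; simpl; ring. }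
    rewrite E; split; [apply Hconj|].
    intros H; rewrite <- Cconj_conj; apply Hconj, H. }
  destruct (polar_exists w) as (t & Ht & E); destruct (polar_exists w') as (t' & Ht' & E').
  rewrite <- Hmod in E'; set (r := Cmod w) in *.
  destruct (Req_dec r 0) as [H0 | H0].
  { replace w' with w; [exact Hw|]; rewrite E, E', H0; unfold polar.
    apply injective_projections; simpl; ring. }
  assert (Hr : 0 < r) by (pose proof (Cmod_ge_0 w); unfold r in *; lra).
  assert (Hcos : cos t <= cos t').
  { rewrite E, E' in Hre; simpl in Hre; apply (Rmult_le_reg_l r); assumption. }
  rewrite E'; apply (proj2 (Habs r t')).
  apply (arc_towards_positive_axis Omega f F r (Rabs t') (Rabs t)); try assumption.
  - split; [apply Rabs_pos | apply Rabs_le_of_cos_le; assumption].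
  - apply (proj1 (Habs r t)); rewrite <- E; exact Hw.
Qed.

Theorem theorem3p1 :
  forall (Omega : C -> Prop) (f : C -> C),
    plane_domain Omega ->
    simply_connected Omega ->
    (exists w : C, ~ Omega w) ->
    Omega (RtoC 0) ->
    conformal_onto unit_disc Omega f ->
    f (RtoC 0) = RtoC 0 ->
    positive_derivative_at f (RtoC 0) ->
    (circularly_symmetric Omega <->
     ((forall z : C, unit_disc z -> f (Cconj z) = Cconj (f z)) /\
      (forall r : R, 0 < r < 1 ->
         decreasing_on 0 PI (fun theta : R => Cmod (f (polar r theta)))))).
Proof.
  intros Omega f (_ & Ho & _) _ _ _ Hconf Hf0 (a & Ha & Hd).
  destruct (conformal_pair_exists Omega f Hconf) as [F Hp].
  apply cderiv_of_is_derive in Hd.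
  split.
  - intros Hcs; pose proof (circularly_symmetric_rightward Omega Ho Hcs) as HO.
    assert (Hconj : forall w, Omega w -> Omega (Cconj w)).
    { intros w; apply HO; [symmetry; apply Cmod_conj | rewrite re_conj; lra]. }
    assert (Hsym : forall z, Cmod z < 1 -> f (Cconj z) = Cconj (f z)).
    { intros z Hz; apply (conformal_symmetric Omega f F a); assumption. }
    split; [exact Hsym|]; intros r Hr; apply im_nonneg_decreasing; [apply Hp | | exact Hr].
    apply (rightward_im_nonneg Omega f F a); assumption.
  - intros [Hsym Hdec]; apply rightward_circularly_symmetric; [exact Ho|].
    apply (symmetric_im_nonneg_rightward Omega f F); try assumption.
    + apply (symmetric_preserves_upper Omega f F a); assumption.
    + apply decreasing_im_nonneg, Hdec.
Qed.
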